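(* Let $(X,\mathcal R)$ and $(Y,\mathcal S)$ be exactly triply regular symmetric $d$-class association schemes having the same Delta–Wye parameters with respect to orderings $A_0,\dots,A_d$, $A'_0,\dots,A'_d$ of their adjacency matrices and $E_0,\dots,E_d$, $E'_0,\dots,E'_d$ of their primitive idempotents, and let $\kappa:\mathbb A\to\mathbb A'$ be the linear map with $\kappa(A_i)=A'_i$ for $0\le i\le d$. Let $F$ be a connected planar graph, possibly with loops and multiple edges, and let $w:E(F)\to\mathbb A$ be any function. Then $$\mathsf S(F,\emptyset;w)=\mathsf S(F,\emptyset;\kappa\circ w).$$
   Context: A symmetric $d$-class association scheme $(X,\mathcal R)$ consists of a finite nonempty set $X$ and a partition $\mathcal R=\{R_0,\dots,R_d\}$ of $X\times X$ into nonempty symmetric relations, with $R_0=\{(x,x):x\in X\}$, such that for all $i,j,k$ the number $p_{ij}^k=|\{z\in X:(x,z)\in R_i,(z,y)\in R_j\}|$ (the intersection numbers) does not depend on the choice of $(x,y)\in R_k$. The adjacency matrix $A_i\in\mathrm{Mat}_X(\mathbb C)$ is the $0/1$ matrix of $R_i$. The Bose–Mesner algebra $\mathbb A=\mathrm{span}\{A_0,\dots,A_d\}$ is commutative and closed under ordinary matrix product and under the entrywise (Schur) product $\circ$; it has a second basis of primitive idempotents $E_0,\dots,E_d$ (symmetric, $E_iE_j=\delta_{ij}E_i$, $\sum_j E_j=I$). Eigenvalues $P_{ji}$ and dual eigenvalues $Q_{ji}$ are defined by $A_i=\sum_j P_{ji}E_j$ and $E_i=|X|^{-1}\sum_j Q_{ji}A_j$,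 and Krein parameters $q_{ij}^k$ by $E_i\circ E_j=|X|^{-1}\sum_k q_{ij}^kE_k$. For $L,M,N\in\mathrm{Mat}_X(\mathbb C)$ define tensors in $(\mathbb C^X)^{\otimes 3}$ (with standard basis vectors $\hat x$, $x\in X$): $\Delta(L,M,N)=\sum_{x,y,z\in X}L_{xz}M_{xy}N_{yz}\,\hat x\otimes\hat y\otimes\hat z$ and $\Upsilon(L,M,N)=\sum_{x,y,z,u\in X}L_{xu}M_{yu}N_{zu}\,\hat x\otimes\hat y\otimes\hat z$. Let $\Delta(\mathbb A)$ and $\Upsilon(\mathbb A)$ be the spans of all $\Delta(L,M,N)$, resp. $\Upsilon(L,M,N)$, with $L,M,N\in\mathbb A$. The scheme is triply regular if $\Upsilon(\mathbb A)\subseteq\Delta(\mathbb A)$, dually triply regular if $\Delta(\mathbb A)\subseteq\Upsilon(\mathbb A)$, and exactly triply regular if both hold. It is known that the tensors $\Upsilon(E_r,E_s,E_t)$ with $q_{rs}^t>0$ form a basis of $\Upsilon(\mathbb A)$. Delta–Wye parameters: if the scheme is exactly triply regular, then for each $i,j,k\in\{0,\dots,d\}$ there are unique scalars $\sigma^{i,j,k}_{r,s,t}$ ($r,s,t$ with $q_{rs}^t>0$; set $\sigma^{i,j,k}_{r,s,t}=0$ when $q_{rs}^t=0$) such that $\Delta(A_i,A_j,A_k)=\sum_{q_{rs}^t>0}\sigma^{i,j,k}_{r,s,t}\,\Upsilon(E_r,E_s,E_t)$. Two exactly triply regular $d$-class schemes $(X,\mathcal R)$, $(Y,\mathcal S)$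 have the same Delta–Wye parameters if there are orderings $A_0,\dots,A_d$ and $A'_0,\dots,A'_d$ of their adjacency matrices and $E_0,\dots,E_d$ and $E'_0,\dots,E'_d$ of their primitive idempotents such that $\sigma^{i,j,k}_{r,s,t}$ computed in $(X,\mathcal R)$ equals the corresponding $\sigma^{i,j,k}_{r,s,t}$ computed in $(Y,\mathcal S)$ for all $i,j,k,r,s,t\in\{0,\dots,d\}$. $\mathbb A'$ denotes the Bose–Mesner algebra of $(Y,\mathcal S)$. Scaffold of order zero: for a finite graph $F$ (loops and multiple edges allowed) and $w:E(F)\to\mathrm{Mat}_X(\mathbb C)$ with symmetric values, $\mathsf S(F,\emptyset;w)=\sum_{\varphi:V(F)\to X}\prod_{e\in E(F)}w(e)_{\varphi(a_e),\varphi(b_e)}$, where $a_e,b_e$ are the ends of $e$ ($a_e=b_e$ for a loop). *)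

(* Defs.v *)
From HB Require Import structures.
From mathcomp Require Import all_boot all_order all_algebra.
From mathcomp Require Import complex.
From mathcomp Require Import reals Rstruct.
From Stdlib Require Import Reals.

Set Implicit Arguments.
Unset Strict Implicit.
Unset Printing Implicit Defensive.

Import Order.TTheory GRing.Theory Num.Theory.

Notation Cplx := (Rdefinitions.R[i]).

Local Open Scope ring_scope.

Section Schemes.
Variables (C : numClosedFieldType) (n d : nat).

(* A symmetric d-class association scheme on X = 'I_n is given by the map
   rel : X -> X -> 'I_d.+1 sending (x,y) to the index i with (x,y) \in R_i;
   thus {R_0,...,R_d} is automatically a partition of X x X, and the
   ordering R_0,...,R_d (hence A_0,...,A_d) is the one given by the indices. *)
Definition is_sym_assoc_scheme (rel : 'I_n -> 'I_n -> 'I_d.+1) : Prop :=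
  [/\ (0 < n)%nat,
      (forall x y, (rel x y == ord0) = (x == y)),
      (forall x y, rel x y = rel y x),
      (forall i, exists x y, rel x y = i) &
      (forall i j k x y x' y', rel x y = k -> rel x' y' = k ->
          #|[set z | (rel x z == i) && (rel z y == j)]|
        = #|[set z | (rel x' z == i) && (rel z y' == j)]|)].

Definition adjmx (rel : 'I_n -> 'I_n -> 'I_d.+1) (i : 'I_d.+1) : 'M[C]_n :=
  \matrix_(x, y) (rel x y == i)%:R.

Definition inBM (rel : 'I_n -> 'I_n -> 'I_d.+1) (M : 'M[C]_n) : Prop :=
  exists c : 'I_d.+1 -> C, M = \sum_i c i *: adjmx rel i.

Definition is_prim_idempotents (rel : 'I_n -> 'I_n -> 'I_d.+1)
    (E : 'I_d.+1 -> 'M[C]_n) : Prop :=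
  [/\ (forall i, inBM rel (E i)),
      (forall i, (E i)^T = E i),
      (forall i j, E i *m E j = if i == j then E i else 0),
      \sum_i E i = 1%:M &
      (forall M, inBM rel M -> exists c : 'I_d.+1 -> C, M = \sum_i c i *: E i)].

Definition schur (M N : 'M[C]_n) : 'M[C]_n := \matrix_(x, y) (M x y * N x y).

Definition krein_pos (E : 'I_d.+1 -> 'M[C]_n) (r s t : 'I_d.+1) : Prop :=
  exists q : 'I_d.+1 -> C,
    schur (E r) (E s) = n%:R^-1 *: \sum_k q k *: E k /\ 0 < q t.

(* tensors in (C^X)^{(x)3}, as coefficient functions *)
Definition tensor := 'I_n -> 'I_n -> 'I_n -> C.

Definition Delta (L M N : 'M[C]_n) : tensor :=
  fun x y z => L x z * M x y * N y z.

Definition Ups (L M N : 'M[C]_n) : tensor :=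
  fun x y z => \sum_u L x u * M y u * N z u.

Definition in_span_of (op : 'M[C]_n -> 'M[C]_n -> 'M[C]_n -> tensor)
    (rel : 'I_n -> 'I_n -> 'I_d.+1) (t : tensor) : Prop :=
  exists s : seq (C * ('M[C]_n * 'M[C]_n * 'M[C]_n)),
    (forall p, p \in s -> [/\ inBM rel p.2.1.1, inBM rel p.2.1.2 & inBM rel p.2.2])
    /\ forall x y z,
         t x y z = \sum_(p <- s) p.1 * op p.2.1.1 p.2.1.2 p.2.2 x y z.

Definition exactly_triply_regular (rel : 'I_n -> 'I_n -> 'I_d.+1) : Prop :=
  (forall t, in_span_of Ups rel t -> in_span_of Delta rel t) /\
  (forall t, in_span_of Delta rel t -> in_span_of Ups rel t).

Definition is_DeltaWye (rel : 'I_n -> 'I_n -> 'I_d.+1) (E : 'I_d.+1 -> 'M[C]_n)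
    (sigma : 'I_d.+1 -> 'I_d.+1 -> 'I_d.+1 -> 'I_d.+1 -> 'I_d.+1 -> 'I_d.+1 -> C)
    : Prop :=
  forall i j k,
    (forall r s t, ~ krein_pos E r s t -> sigma i j k r s t = 0) /\
    forall x y z,
      Delta (adjmx rel i) (adjmx rel j) (adjmx rel k) x y z
      = \sum_r \sum_s \sum_t sigma i j k r s t * Ups (E r) (E s) (E t) x y z.

End Schemes.

(* ---------- Finite graphs with loops and multiple edges ----------
   A graph F is given by a finite vertex type V, a finite edge type Ed and
   ends : Ed -> V * V giving the ends (a_e, b_e) of each edge (a_e = b_e for
   a loop). *)
Section Graphs.
Variables (V Ed : finType) (ends : Ed -> V * V).

Definition gadj : rel V :=
  fun u v => [exists e, (ends e == (u, v)) || (ends e == (v, u))].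

Definition connected_graph : Prop :=
  (0 < #|V|)%nat /\ forall u v, connect gadj u v.

(* Planarity: existence of a drawing in R^2.  Vertices go to distinct
   points; each edge e is a continuous curve gamma_e : [0,1] -> R^2 from
   a_e to b_e, injective except that a loop closes up (gamma_e 0 = gamma_e 1);
   edge interiors avoid all vertex points and are pairwise disjoint. *)
Local Open Scope R_scope.

Definition unitI (t : R) : Prop := 0 <= t <= 1.
Definition openI (t : R) : Prop := 0 < t < 1.

Definition planar_graph : Prop :=
  exists (px py : V -> R) (gx gy : Ed -> R -> R),
    (forall u v, px u = px v -> py u = py v -> u = v) /\
    (forall e t, unitI t -> continue_in (gx e) unitI t /\ continue_in (gy e) unitI t) /\
    (forall e, gx e 0 = px (ends e).1 /\ gy e 0 = py (ends e).1 /\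
               gx e 1 = px (ends e).2 /\ gy e 1 = py (ends e).2) /\
    (forall e s t, unitI s -> unitI t -> s < t ->
        gx e s = gx e t -> gy e s = gy e t ->
        s = 0 /\ t = 1 /\ (ends e).1 = (ends e).2) /\
    (forall e t v, openI t -> ~ (gx e t = px v /\ gy e t = py v)) /\
    (forall e e' s t, e <> e' -> openI s -> openI t ->
        ~ (gx e s = gx e' t /\ gy e s = gy e' t)).

End Graphs.

Local Open Scope ring_scope.

Definition scaffold0 (C : numClosedFieldType) (n : nat) (V Ed : finType)
    (ends : Ed -> V * V) (w : Ed -> 'M[C]_n) : C :=
  \sum_(phi : {ffun V -> 'I_n}) \prod_(e : Ed) w e (phi (ends e).1) (phi (ends e).2).

(* Main.v *)
From Stdlib Require Import Reals Lra.
From Coquelicot Require Compactness Rcomplements.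
Require Import Defs.
From HB Require Import structures.
From mathcomp Require Import all_boot all_order all_algebra.
From mathcomp Require Import ring zify.
From mathcomp Require boolp.
From mathcomp Require Import complex.
From mathcomp Require Import reals Rstruct.

(** Let b_j(M) act by the matrix M on the j-th tensor factor of (C^X)^{(x)k} and let
    a_j(M) multiply by M(x_j, x_(j+1)), for M in the Bose-Mesner algebra.  The spaces
    G_(2j) = {b_j(M)} and G_(2j+1) = {a_j(M)} are algebras, distant ones commute, and
    exact triple regularity says that G_i G_(i+1) G_i and G_(i+1) G_i G_(i+1) span the
    same space, so the algebra they generate behaves like a Hecke algebra: every element
    is a sum of words in which the last generator occurs at most once.  Moreover the
    trace is Markov: tr (g x) is a multiple of tr x when g lies in G_m and x in the
    algebra of the previous generators, because M has constant diagonal and constant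
    row sums.  Equality of Delta-Wye parameters makes all this data agree for the two
    schemes, hence the traces of corresponding words agree.  Partition functions of
    square grids are such traces.  Finally, pixelating a drawing exhibits every planar
    graph as a minor of a grid, and in a scaffold contraction and deletion of an edge
    amount to giving it weight I and J, both in the Bose-Mesner algebra. *)

Set Implicit Arguments.
Unset Strict Implicit.
Unset Printing Implicit Defensive.

Import Order.TTheory GRing.Theory Num.Theory.

Local Open Scope ring_scope.

(** * Markov traces on braid-like algebras *)

(** The map [kappa] is never extended to words. Both schemes are run at once inside the product of
    two matrix rings, with the pairs having equal coefficients as generators, and the functional
    followed is the difference of the two traces. It kills 1 because the column sums of [sigma]
    force |X| = |Y|, and the Markov property carries vanishing along; no normal form of words and no
    well-definedness is involved. What the pairs demand is that each structural identity holds in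
    both schemes with the same scalars. Hence the order, the trivial idempotent and the eigenvalues
    are all extracted from [sigma]. Since [sigma] only expands triangles into stars, the opposite
    expansion is transferred through a left inverse of [sigma]. In the grid, links leaving the last
    column would wrap to strand 0, where no generator is available, so they carry weight J. Parallel
    edges may share one link, because entrywise products stay in the algebra; loops contribute
    scalars, because diagonals are constant. *)

Section BraidLikeAlgebra.
Variables (A : pzRingType) (G : nat -> A -> Prop).

(** Shaped as a list of summands u g v, so that proofs induct on the summands. There is no
    constructor for scalars: a scalar has to be absorbed into one of the factors. *)
Inductive sandwich (S T : A -> Prop) : A -> Prop :=
| sandwich0 : sandwich S T 0
| sandwich_cons u g v x : S u -> T g -> S v -> sandwich S T x ->
    sandwich S T (u * g * v + x).

(** For m = 0 only positive multiples of 1 remain; they are central, which starts the inductions on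
    m. *)
Inductive gen_alg (m : nat) : A -> Prop :=
| gen_alg1 : gen_alg m 1
| gen_alg_gen i x : (i < m)%N -> G i x -> gen_alg m x
| gen_algD x y : gen_alg m x -> gen_alg m y -> gen_alg m (x + y)
| gen_algM x y : gen_alg m x -> gen_alg m y -> gen_alg m (x * y).

Variable M : nat.
Hypothesis G1 : forall i, (i < M)%N -> G i 1.
Hypothesis GM : forall i x y, (i < M)%N -> G i x -> G i y -> G i (x * y).
Hypothesis Gcomm : forall i j x y, (i.+1 < j)%N -> (j < M)%N ->
  G i x -> G j y -> x * y = y * x.
Hypothesis braid : forall i x y z, (i.+1 < M)%N ->
  G i.+1 x -> G i y -> G i.+1 z -> sandwich (G i) (G i.+1) (x * y * z).

Lemma sandwichD (S T : A -> Prop) x y :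
  sandwich S T x -> sandwich S T y -> sandwich S T (x + y).
Proof.
move=> hx hy; elim: hx => [|u g v {}x hu hg hv _ IH]; first by rewrite add0r.
by rewrite -addrA; apply: sandwich_cons.
Qed.

Lemma sandwich_in (S T : A -> Prop) u g v :
  S u -> T g -> S v -> sandwich S T (u * g * v).
Proof.
by move=> hu hg hv; rewrite -[_ * v]addr0; apply: sandwich_cons => //; exact: sandwich0.
Qed.

Lemma gen_alg_le m m' x : (m <= m')%N -> gen_alg m x -> gen_alg m' x.
Proof.
move=> le_mm'; elim=> [|i {}x lt_im Gx|y z _ hy _ hz|y z _ hy _ hz].
- exact: gen_alg1.
- exact: gen_alg_gen (leq_trans lt_im le_mm') Gx.
- exact: gen_algD.
- exact: gen_algM.
Qed.

Lemma gen_alg_comm m x z : (forall i y, (i < m)%N -> G i y -> y * z = z * y) ->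
  gen_alg m x -> x * z = z * x.
Proof.
move=> com; elim=> [|i {}x /com h /h //|y y' _ hy _ hy'|y y' _ hy _ hy'].
- by rewrite mul1r mulr1.
- by rewrite mulrDl mulrDr hy hy'.
- by rewrite -mulrA hy' !mulrA hy.
Qed.

Lemma sandwich_mul_alg m x u v : gen_alg m u -> gen_alg m v ->
  sandwich (gen_alg m) (G m) x -> sandwich (gen_alg m) (G m) (u * x * v).
Proof.
move=> hu hv; elim=> [|u' g v' {}x hu' hg hv' _ IH].
  by rewrite mulr0 mul0r; exact: sandwich0.
rewrite mulrDr mulrDl; apply: sandwichD => //.
by rewrite !mulrA -(mulrA _ v' v); apply: sandwich_in => //; exact: gen_algM.
Qed.

(* The Hecke-algebra argument: G_m (gen_alg m) G_m collapses because gen_alg m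
   has G_(m-1) once in each term and the outer factors commute with G_m. *)
Lemma gen_alg_sandwich m : (m < M)%N ->
  forall x, gen_alg m.+1 x -> sandwich (gen_alg m) (G m) x.
Proof.
elim: m => [|m IHm] ltmM.
  have sand1 : sandwich (gen_alg 0) (G 0) 1.
    by rewrite -[1]mulr1 -{1}[1]mulr1; apply: sandwich_in; [exact: gen_alg1|exact: G1|exact: gen_alg1].
  have comm0 y z : gen_alg 0 y -> y * z = z * y by apply: gen_alg_comm.
  move=> x; elim=> [|i {}x|y z _ hy _ hz|y z _ hy _ hz] //.
  - rewrite ltnS leqn0 => /eqP-> Gx.
    by rewrite -[x]mulr1 -[x]mul1r; apply: sandwich_in => //; exact: gen_alg1.
  - exact: sandwichD.
  elim: hy => [|u g v {}y hu hg hv _ IH]; first by rewrite mul0r; exact: sandwich0.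
  rewrite mulrDl; apply: sandwichD IH.
  elim: hz => [|u' g' v' {}z hu' hg' hv' _ IH]; first by rewrite mulr0; exact: sandwich0.
  rewrite mulrDr; apply: sandwichD IH.
  rewrite -(mulrA (u * g)) -(mulrA u') (mulrA v) (comm0 _ _ (gen_algM hv hu')).
  rewrite -[g' * v' * _]mulrA !mulrA -(mulrA u g) -!mulrA (mulrA v') (mulrA g) mulrA.
  by apply: sandwich_in => //; [exact: GM | do !apply: gen_algM].
have sand1 : sandwich (gen_alg m.+1) (G m.+1) 1.
  by rewrite -[1]mulr1 -{1}[1]mulr1; apply: sandwich_in; [exact: gen_alg1|exact: G1|exact: gen_alg1].
have gcomm g p : G m.+1 g -> gen_alg m p -> p * g = g * p.
  move=> hg; apply: gen_alg_comm => i y ltim Gy.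
  by apply: Gcomm Gy hg; rewrite ?ltnS.
move=> x; elim=> [|i {}x|y z _ hy _ hz|y z _ hy _ hz] //.
- rewrite ltnS leq_eqVlt => /predU1P[-> Gx|ltim Gx].
    by rewrite -[x]mulr1 -[x]mul1r; apply: sandwich_in => //; exact: gen_alg1.
  rewrite -[x]mulr1 -[x]mulr1; apply: sandwich_in; last exact: gen_alg1.
    exact: gen_alg_gen Gx.
  exact: G1.
- exact: sandwichD.
elim: hy => [|u g v {}y hu hg hv _ IH]; first by rewrite mul0r; exact: sandwich0.
rewrite mulrDl; apply: sandwichD IH.
elim: hz => [|u' g' v' {}z hu' hg' hv' _ IH]; first by rewrite mulr0; exact: sandwich0.
rewrite mulrDr; apply: sandwichD IH.
suff: sandwich (gen_alg m.+1) (G m.+1) (g * (v * u') * g').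
  by move=> /(sandwich_mul_alg hu hv'); rewrite !mulrA.
have := IHm (ltnW ltmM) _ (gen_algM hv hu'); elim=> [|p h q y0 hp hh hq _ IH].
  by rewrite mulr0 mul0r; exact: sandwich0.
rewrite mulrDr mulrDl; apply: sandwichD IH.
rewrite !mulrA -(gcomm g p) // -!mulrA (gcomm g' q) // !mulrA -(mulrA p) -(mulrA p).
apply: sandwich_mul_alg; try exact: gen_alg_le (leqnSn m) _.
elim: (braid ltmM hg hh hg') => [|h1 g1 h2 y1 hh1 hg1 hh2 _ IH]; first exact: sandwich0.
by apply: sandwich_cons => //; apply: gen_alg_gen (leqnn m.+1) _.
Qed.

Variables (K : pzRingType) (f : A -> K).
Hypothesis f0 : f 0 = 0.
Hypothesis fD : forall x y, f (x + y) = f x + f y.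
Hypothesis fC : forall x y, f (x * y) = f (y * x).
Hypothesis f1 : f 1 = 0.
Hypothesis markov : forall m g x, (m < M)%N -> G m g -> gen_alg m x ->
  exists c, f (g * x) = c * f x.

(** Cyclicity turns u g v into g (v u), where v u involves earlier generators only, and the Markov
    property strips g. As only vanishing is claimed, the multiplier may depend on g and x. *)
Lemma markov_trace_eq0 x : gen_alg M x -> f x = 0.
Proof.
have: (M <= M)%N by []; elim: {1 3}M x => [|m IHm] x leM.
  (* The product case of the induction needs an arbitrary right factor in the kernel of f. *)
  suff /(_ 1) : forall y, gen_alg 0 x -> f y = 0 -> f (x * y) = 0 by rewrite mulr1; auto.
  move=> y hx; elim: hx y => [|//|{}x z _ hx _ hz|{}x z _ hx _ hz] y fy.
  - by rewrite mul1r.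
  - by rewrite mulrDl fD hx // hz // addr0.
  - by rewrite -mulrA hx // hz.
move/(gen_alg_sandwich leM); elim=> [//|u g v y hu hg hv _ IH].
rewrite fD IH addr0 -mulrA fC -mulrA.
have hvu := gen_algM hv hu; have [c ->] := markov leM hg hvu.
by rewrite IHm ?mulr0 // ltnW.
Qed.

End BraidLikeAlgebra.

(** * Bose-Mesner algebras and Delta-Wye parameters *)

(** In the rank factorisation of e, idempotency makes the product of the two factors in reverse
    order the identity of size rank e; cyclicity of the trace concludes. *)
Lemma mxtrace_idempotent (F : fieldType) (n : nat) (e : 'M[F]_n) :
  e *m e = e -> \tr e = (\rank e)%:R.
Proof.
move=> ee; have rc : row_base e *m col_base e = 1%:M.
  apply: (row_free_inj (row_base_free e)); apply: (row_full_inj (col_base_full e)).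
  by rewrite mul1mx -mulmxA (mulmxA (col_base e)) !mulmx_base ee.
by rewrite -{1}[e]mulmx_base mxtrace_mulC rc mxtrace1.
Qed.

Lemma sum_delta (R : pzSemiRingType) (I : finType) (i : I) (F : I -> R) :
  \sum_j (j == i)%:R * F j = F i.
Proof.
rewrite (bigD1 i) //= eqxx mul1r big1 ?addr0 // => j /negbTE->.
by rewrite mul0r.
Qed.

Lemma sum_triple (R : nmodType) (I : finType) (F : I -> I -> I -> R) :
  \sum_r \sum_s \sum_t F r s t = \sum_(p : I * I * I) F p.1.1 p.1.2 p.2.
Proof. by rewrite pair_bigA pair_bigA. Qed.

Section BoseMesner.
Variables (C : numClosedFieldType) (n d : nat) (rel : 'I_n -> 'I_n -> 'I_d.+1).

Definition bm (c : 'I_d.+1 -> C) : 'M[C]_n := \sum_i c i *: adjmx C rel i.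

Lemma bmE c x y : bm c x y = c (rel x y).
Proof.
rewrite /bm summxE -[RHS](sum_delta _ c); apply: eq_bigr => i _.
by rewrite !mxE mulrC eq_sym.
Qed.

Lemma schur_bm c c' : schur (bm c) (bm c') = bm (fun i => c i * c' i).
Proof. by apply/matrixP=> x y; rewrite !mxE !bmE. Qed.

Lemma adjmx_bm i : adjmx C rel i = bm (fun j => (j == i)%:R).
Proof. by apply/matrixP=> x y; rewrite !mxE bmE. Qed.

Lemma bm_const1 : bm (fun=> 1) = const_mx 1.
Proof. by apply/matrixP=> x y; rewrite !mxE bmE. Qed.

Lemma eq_bm c c' : c =1 c' -> bm c = bm c'.
Proof. by move=> cc'; apply/matrixP=> x y; rewrite !bmE cc'. Qed.

Lemma bm_sum (I : finType) (a : I -> C) (c : I -> 'I_d.+1 -> C) :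
  \sum_i a i *: bm (c i) = bm (fun j => \sum_i a i * c i j).
Proof.
apply/matrixP=> x y; rewrite summxE bmE; apply: eq_bigr => i _.
by rewrite !mxE bmE.
Qed.

Hypothesis rel_scheme : is_sym_assoc_scheme rel.

Let n_gt0 : (0 < n)%N. Proof. by case: rel_scheme. Qed.
Let n_neq0 : n%:R != 0 :> C. Proof. by rewrite pnatr_eq0 -lt0n. Qed.

Lemma rel_diag x : rel x x = ord0.
Proof. by case: rel_scheme => _ /(_ x x) + _ _ _; rewrite eqxx => /eqP. Qed.

Lemma bm_id : bm (fun i => (i == ord0)%:R) = 1%:M.
Proof.
case: rel_scheme => _ r0 _ _ _.
by apply/matrixP=> x y; rewrite bmE !mxE r0.
Qed.

Lemma bm_sym c : (bm c)^T = bm c.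
Proof. by case: rel_scheme => _ _ rs _ _; apply/matrixP=> x y; rewrite mxE !bmE rs. Qed.

Lemma bm_inj c c' : bm c = bm c' -> c =1 c'.
Proof.
case: rel_scheme => _ _ _ ne _ cc' i; have [x [y <-]] := ne i.
by move/matrixP/(_ x y): cc'; rewrite !bmE.
Qed.

Variable E : 'I_d.+1 -> 'M[C]_n.
Hypothesis E_prim : is_prim_idempotents rel E.

Let E_inBM r : inBM rel (E r). Proof. by case: E_prim. Qed.
Let E_sym r : (E r)^T = E r. Proof. by case: E_prim. Qed.
Let E_mul r s : E r *m E s = (r == s)%:R *: E r.
Proof. by case: E_prim => _ _ -> _ _; case: eqP => _; rewrite ?scale1r ?scale0r. Qed.
Let E_span c : exists a : 'I_d.+1 -> C, bm c = \sum_i a i *: E i.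
Proof. by case: E_prim => _ _ _ _; apply; exists c. Qed.

Lemma sumE_mulE a s : (\sum_r a r *: E r) *m E s = a s *: E s.
Proof.
rewrite mulmx_suml (bigD1 s) //= -scalemxAl E_mul eqxx scale1r big1 ?addr0 // => r /negbTE rs.
by rewrite -scalemxAl E_mul rs scale0r scaler0.
Qed.

Lemma sumE_mul a b : (\sum_r a r *: E r) *m (\sum_r b r *: E r) = \sum_r (a r * b r) *: E r.
Proof.
rewrite mulmx_sumr; apply: eq_bigr => r _.
by rewrite -scalemxAr sumE_mulE scalerA mulrC.
Qed.

Lemma idempotents_in_bm : exists Q : 'I_d.+1 -> 'I_d.+1 -> C, forall r, E r = bm (Q r).
Proof. exact: fin_all_exists (fun r => E_inBM r). Qed.

(** A dimension count: the d + 1 matrices E r span an algebra of dimension d + 1, so the change of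
    basis matrices P and Q are mutually inverse, and a zero E r would be a zero row of Q. *)
Lemma idempotent_neq0 r : E r != 0.
Proof.
have [Q QE] := idempotents_in_bm.
have [P PE] : exists P : 'I_d.+1 -> 'I_d.+1 -> C,
    forall i, adjmx C rel i = \sum_r P i r *: E r.
  apply: (@fin_all_exists _ _ (fun i p => adjmx C rel i = \sum_r0 p r0 *: E r0)) => i.
  by rewrite adjmx_bm; exact: E_span.
have PQ : (\matrix_(i, r) P i r) *m (\matrix_(r, i) Q r i) = 1%:M :> 'M[C]_d.+1.
  apply/matrixP=> i j; rewrite !mxE.
  have := PE i; under eq_bigr do rewrite QE.
  rewrite bm_sum adjmx_bm => /bm_inj/(_ j).
  by rewrite eq_sym => ->; apply: eq_bigr => s _; rewrite !mxE.
apply/eqP=> Er0; have Q0 : Q r =1 (fun=> 0).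
  apply: bm_inj; rewrite -QE Er0; apply/matrixP=> x y.
  by rewrite bmE mxE.
have /matrixP/(_ r r) := mulmx1C PQ; rewrite !mxE eqxx big1 => [/esym/eqP|s _].
  by rewrite oner_eq0.
by rewrite !mxE Q0 mul0r.
Qed.

Lemma sumE_inj a b : \sum_r a r *: E r = \sum_r b r *: E r -> a =1 b.
Proof.
move=> ab r; have : a r *: E r = b r *: E r by rewrite -!sumE_mulE ab.
move/eqP; rewrite -subr_eq0 -scalerBl scaler_eq0 (negbTE (idempotent_neq0 r)) orbF subr_eq0.
by move/eqP.
Qed.

Lemma mxtrace_idempotent_gt0 r : 0 < \tr (E r).
Proof.
rewrite mxtrace_idempotent; last by rewrite E_mul eqxx scale1r.
by rewrite ltr0n lt0n mxrank_eq0 idempotent_neq0.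
Qed.

(* conj (E r) is again a symmetric idempotent of the algebra, and
   E r *m conj (E r) = E r *m (E r)^* is nonzero, which forces conj (E r) = E r. *)
Lemma idempotent_real r x y : (E r x y)^* = E r x y.
Proof.
pose F := map_mx Num.conj (E r).
have [c Ec] := E_inBM r.
have Fbm : F = bm (fun i => (c i)^*).
  by apply/matrixP=> x' y'; rewrite mxE Ec bmE [bm _ _ _]bmE.
have [a Fa] := E_span (fun i => (c i)^*).
have FE : F *m E r = a r *: E r by rewrite Fbm Fa sumE_mulE.
have EF : E r *m F = a r *: E r.
  by apply: trmx_inj; rewrite trmx_mul E_sym map_trmx E_sym -/F FE linearZ /= E_sym.
have FF : F *m F = F by rewrite -map_mxM E_mul eqxx scale1r.
have a2 : a r * a r = a r.
  have := congr1 (fun M => M *m E r) FF; rewrite -mulmxA FE -scalemxAr FE scalerA.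
  move/eqP; rewrite -subr_eq0 -scalerBl scaler_eq0 (negbTE (idempotent_neq0 r)) orbF subr_eq0.
  by move/eqP.
have a_neq0 : a r != 0.
  apply/eqP=> a0; case/eqP: (idempotent_neq0 r); apply/matrixP=> x' y'; rewrite mxE.
  move/matrixP/(_ x' x'): EF; rewrite a0 scale0r !mxE => /eqP.
  have EFxx z : E r x' z * F z x' = `|E r x' z| ^+ 2.
    have Es : E r x' z = E r z x' by rewrite -{1}E_sym mxE.
    by rewrite normCK Es mxE.
  rewrite psumr_eq0 => [/allP/(_ y' (mem_index_enum _))/=|z _].
    by rewrite EFxx sqrf_eq0 normr_eq0 => /eqP.
  by rewrite EFxx exprn_ge0.
have a1 : a r = 1 by apply: (mulIf a_neq0); rewrite a2 mul1r.
have EFE : E r *m F = E r by rewrite EF a1 scale1r.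
have FEE : F *m E r = E r by rewrite FE a1 scale1r.
suff /matrixP/(_ x y): F = E r by rewrite mxE.
have := congr1 (map_mx Num.conj) FEE; rewrite map_mxM.
have -> : map_mx Num.conj F = E r by apply/matrixP=> x' y'; rewrite !mxE conjCK.
by rewrite EFE -/F => <-.
Qed.

(** The all-ones matrix J is in the algebra, so it has a nonzero eigenvalue on some E t, and J^2 = n
    J makes it n. Then n E t = J E t has equal rows, symmetry makes E t constant, and idempotency
    fixes the constant. *)
Lemma trivial_idempotent : exists t0, E t0 = n%:R^-1 *: const_mx 1.
Proof.
have [a Ja] := E_span (fun=> 1); rewrite bm_const1 in Ja.
have [t at0] : exists t, a t != 0.
  apply/existsP; rewrite -[[exists _, _]]negbK negb_exists; apply/negP => /forallP a0.
  have /matrixP/(_ (Ordinal n_gt0) (Ordinal n_gt0)) := Ja.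
  rewrite big1 => [|i _]; last by rewrite (eqP (negbNE (a0 i))) scale0r.
  by rewrite !mxE => /eqP; rewrite oner_eq0.
pose J : 'M[C]_n := const_mx 1.
have JJ : J *m J = n%:R *: J.
  apply/matrixP=> x y; rewrite !mxE mulr1 (eq_bigr (fun=> 1)) => [|i _]; last by rewrite !mxE mulr1.
  by rewrite sumr_const card_ord.
have JE : J *m E t = a t *: E t by rewrite /J Ja sumE_mulE.
have atn : a t = n%:R.
  have := congr1 (mulmxr (E t)) JJ; rewrite /= -mulmxA JE -scalemxAr -scalemxAl JE !scalerA.
  move/eqP; rewrite -subr_eq0 -scalerBl scaler_eq0 (negbTE (idempotent_neq0 t)) orbF subr_eq0.
  by move=> /eqP/(mulIf at0).
have EJ x y x' : E t x y = E t x' y.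
  have h z : n%:R * E t z y = \sum_u E t u y.
    have /matrixP/(_ z y) := JE; rewrite atn !mxE => <-.
    by apply: eq_bigr => u _; rewrite mxE mul1r.
  by apply: (mulfI n_neq0); rewrite !h.
have Es x y : E t x y = E t y x by rewrite -{1}E_sym mxE.
pose x0 := Ordinal n_gt0; pose c := E t x0 x0.
have Ec x y : E t x y = c by rewrite (EJ x y x0) Es (EJ y x0 x0).
exists t; apply/matrixP=> x y; rewrite Ec !mxE mulr1.
have c0 : c != 0.
  apply/eqP=> c0; case/eqP: (idempotent_neq0 t).
  by apply/matrixP=> u v; rewrite Ec c0 mxE.
have /matrixP/(_ x y) := E_mul t t; rewrite eqxx scale1r Ec mxE.
rewrite (eq_bigr (fun=> c * c)) => [|u _]; last by rewrite !Ec.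
rewrite sumr_const card_ord => h.
by apply: (mulfI n_neq0); rewrite mulfV //; apply: (mulIf c0); rewrite -mulrA mulr_natl h mul1r.
Qed.

(** Summing out the three legs first leaves a double sum over the centres u and v of the two
    stars. *)
Lemma Ups_inner (L M N L' M' N' : 'M[C]_n) :
  \sum_x \sum_y \sum_z Ups L M N x y z * Ups L' M' N' x y z =
  \sum_u \sum_v (L^T *m L') u v * (M^T *m M') u v * (N^T *m N') u v.
Proof.
transitivity (\sum_x \sum_y \sum_z \sum_u \sum_v
    (L x u * L' x v) * (M y u * M' y v) * (N z u * N' z v)).
  apply: eq_bigr => x _; apply: eq_bigr => y _; apply: eq_bigr => z _.
  rewrite /Ups mulr_suml; apply: eq_bigr => u _.
  rewrite mulr_sumr; apply: eq_bigr => v _.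
  by ring.
under eq_bigr do under eq_bigr do rewrite exchange_big /=.
under eq_bigr do rewrite exchange_big /=.
rewrite exchange_big; apply: eq_bigr => u _ /=.
under eq_bigr do under eq_bigr do rewrite exchange_big /=.
under eq_bigr do rewrite exchange_big /=.
rewrite exchange_big; apply: eq_bigr => v _ /=.
rewrite !mxE !mulr_suml; apply: eq_bigr => x _; rewrite !mxE -mulrA mulr_suml mulr_sumr.
apply: eq_bigr => y _; rewrite !mxE !mulr_sumr.
by apply: eq_bigr => z _; rewrite !mxE !mulrA.
Qed.

(** The value of the bilinear form on [Ups (E r) (E s) (E t)] with itself; it equals the Krein
    parameter times the trace of E t, divided by n. *)
Definition krein_trace r s t : C := \sum_u \sum_v E r u v * E s u v * E t u v.

Lemma Ups_orthogonal r s t r' s' t' :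
  \sum_x \sum_y \sum_z Ups (E r) (E s) (E t) x y z * Ups (E r') (E s') (E t') x y z =
  ((r == r') && (s == s') && (t == t'))%:R * krein_trace r s t.
Proof.
rewrite Ups_inner !E_sym !E_mul /krein_trace mulr_sumr; apply: eq_bigr => u _.
rewrite mulr_sumr; apply: eq_bigr => v _; rewrite !mxE -!mulnb !natrM.
by move: (_%:R) (_%:R) (_%:R) => a b c; ring.
Qed.

Lemma krein_traceE r s t q : schur (E r) (E s) = n%:R^-1 *: \sum_k q k *: E k ->
  krein_trace r s t = n%:R^-1 * q t * \tr (E t).
Proof.
move=> qE; have := congr1 (fun M => \tr (M *m E t)) qE.
rewrite -scalemxAl sumE_mulE scalerA mxtraceZ => <-.
apply: eq_bigr => u _; rewrite mxE; apply: eq_bigr => v _.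
by rewrite mxE; congr (_ * _); rewrite -{1}E_sym mxE.
Qed.

Lemma krein_pos_trace r s t : krein_pos E r s t -> krein_trace r s t != 0.
Proof.
move=> [q [qE q_gt0]]; rewrite (krein_traceE t qE).
by rewrite !mulf_neq0 ?invr_eq0 // gt_eqF // mxtrace_idempotent_gt0.
Qed.

(** The idempotents are real, so [krein_trace] is a sum of squares of the entries of the tensor and
    is positive as soon as one entry is nonzero. *)
Lemma Ups_neq0_krein_pos r s t x y z :
  Ups (E r) (E s) (E t) x y z != 0 -> krein_pos E r s t.
Proof.
move=> U_neq0.
have [c Ec] := idempotents_in_bm.
have [q qE] := E_span (fun i => c r i * c s i).
have schurE : schur (E r) (E s) = n%:R^-1 *: \sum_k (n%:R * q k) *: E k.
  rewrite !Ec schur_bm qE scaler_sumr; apply: eq_bigr => k _.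
  by rewrite scalerA mulrA mulVf // mul1r.
exists (fun k => n%:R * q k); split=> //.
have U_real x' y' z' : (Ups (E r) (E s) (E t) x' y' z')^* = Ups (E r) (E s) (E t) x' y' z'.
  by rewrite rmorph_sum /=; apply: eq_bigr => u _; rewrite !rmorphM /= !idempotent_real.
have sq_ge0 x' y' z' :
    0 <= Ups (E r) (E s) (E t) x' y' z' * Ups (E r) (E s) (E t) x' y' z'.
  by rewrite -{2}U_real -normCK exprn_ge0.
have : 0 < krein_trace r s t.
  have := Ups_orthogonal r s t r s t; rewrite !eqxx mul1r => <-.
  rewrite lt_def; apply/andP; split; last by do 3!(apply: sumr_ge0 => ? _).
  apply: contra U_neq0; rewrite psumr_eq0 => [|? _]; last by do 2!(apply: sumr_ge0 => ? _).
  move=> /allP/(_ x (mem_index_enum _))/=; rewrite psumr_eq0 => [|? _]; last by apply: sumr_ge0.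
  move=> /allP/(_ y (mem_index_enum _))/=; rewrite psumr_eq0 => [|? _] //.
  by move=> /allP/(_ z (mem_index_enum _))/=; rewrite mulf_eq0 orbb.
by rewrite (krein_traceE t schurE) pmulr_lgt0 ?mxtrace_idempotent_gt0 // pmulr_rgt0 ?invr_gt0 ?ltr0n.
Qed.

Definition idx := ('I_d.+1 * 'I_d.+1 * 'I_d.+1)%type.
Definition UpsE (p : idx) : tensor C n := Ups (E p.1.1) (E p.1.2) (E p.2).
Definition DeltaA (p : idx) : tensor C n :=
  Delta (adjmx C rel p.1.1) (adjmx C rel p.1.2) (adjmx C rel p.2).
Definition UpsA (p : idx) : tensor C n :=
  Ups (adjmx C rel p.1.1) (adjmx C rel p.1.2) (adjmx C rel p.2).

(** Pairing with [UpsE p] isolates the coefficient at p by orthogonality; it can be divided out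
    because the square of [UpsE p] is nonzero at Krein-positive p. *)
Lemma UpsE_coef (c c' : idx -> C) :
  (forall x y z, \sum_p c p * UpsE p x y z = \sum_p c' p * UpsE p x y z) ->
  forall p, krein_pos E p.1.1 p.1.2 p.2 -> c p = c' p.
Proof.
move=> cc' p /krein_pos_trace kt.
have coefE (a : idx -> C) :
    \sum_x \sum_y \sum_z (\sum_q a q * UpsE q x y z) * UpsE p x y z =
    a p * krein_trace p.1.1 p.1.2 p.2.
  rewrite sum_triple; under eq_bigr do rewrite mulr_suml.
  rewrite exchange_big /= -[a p * _](sum_delta p (fun q => a q * krein_trace q.1.1 q.1.2 q.2)).
  apply: eq_bigr => q _.
  have -> : (q == p) = (q.1.1 == p.1.1) && (q.1.2 == p.1.2) && (q.2 == p.2).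
    by case: q p {kt} => [[? ?] ?] [[? ?] ?].
  rewrite mulrCA -Ups_orthogonal sum_triple mulr_sumr.
  by apply: eq_bigr => t _; rewrite mulrA.
apply: (mulIf kt); rewrite -!coefE.
by apply: eq_bigr => x _; apply: eq_bigr => y _; apply: eq_bigr => z _; rewrite cc'.
Qed.

(** Summing out a leg applies E t to the all-ones vector, which is zero unless t = t0; the two other
    legs then compose to E r E s. *)
Lemma sum_Ups_idempotent t0 r s t x y : E t0 = n%:R^-1 *: const_mx 1 ->
  \sum_z Ups (E r) (E s) (E t) x y z = ((t == t0) && (r == s))%:R * E r x y.
Proof.
move=> Et0.
have colsum u : \sum_z E t z u = (t == t0)%:R.
  have /matrixP/(_ u u) := E_mul t0 t; rewrite Et0 eq_sym -scalemxAl !mxE mulr1.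
  rewrite mulrC => /(mulIf (invr_neq0 n_neq0)) <-.
  by apply: eq_bigr => z _; rewrite mxE mul1r.
rewrite exchange_big /= -mulnb natrM -mulrA.
have /matrixP/(_ x y) := E_mul r s; rewrite [in RHS]mxE => <-.
rewrite mxE mulr_sumr; apply: eq_bigr => u _.
rewrite -mulr_sumr colsum mulrC; congr (_ * (_ * _)).
by rewrite -{1}E_sym mxE.
Qed.

Lemma sum_DeltaA x y z : \sum_p DeltaA p x y z = 1.
Proof.
rewrite -(sum_triple (fun i j k => Delta (adjmx C rel i) (adjmx C rel j) (adjmx C rel k) x y z)).
rewrite /Delta; under eq_bigr do under eq_bigr do rewrite -mulr_sumr.
under eq_bigr do rewrite -mulr_suml -mulr_sumr.
rewrite -!mulr_suml.
have sum1 u v : \sum_i adjmx C rel i u v = 1.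
  by rewrite -[RHS](bmE (fun=> 1) u v) summxE; apply: eq_bigr => i _; rewrite scale1r.
by rewrite !sum1 !mulr1.
Qed.

Lemma sum_DeltaA_diag i x y :
  \sum_z DeltaA (i, i, ord0) x y z = adjmx C rel i x y.
Proof.
case: rel_scheme => _ r0 _ _ _; rewrite (bigD1 y) //= big1 => [|z zy].
  by rewrite /DeltaA /Delta /= !mxE r0 eqxx mulr1 addr0; case: eqP => _; rewrite ?mulr1 ?mulr0.
by rewrite /DeltaA /Delta /= !mxE r0 (eq_sym y) (negbTE zy) mulr0.
Qed.

Lemma UpsE_trivial t0 x y z : E t0 = n%:R^-1 *: const_mx 1 ->
  n%:R ^+ 2 * UpsE (t0, t0, t0) x y z = 1.
Proof.
move=> Et0; rewrite /UpsE /Ups /= Et0.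
rewrite (eq_bigr (fun=> n%:R^-1 * n%:R^-1 * n%:R^-1)) => [|u _]; last by rewrite !mxE !mulr1.
rewrite sumr_const card_ord -[X in _ * X]mulr_natl; field.
exact: n_neq0.
Qed.

Variable sigma : 'I_d.+1 -> 'I_d.+1 -> 'I_d.+1 -> 'I_d.+1 -> 'I_d.+1 -> 'I_d.+1 -> C.
Hypothesis DW : is_DeltaWye rel E sigma.

Definition sg (p q : idx) : C := sigma p.1.1 p.1.2 p.2 q.1.1 q.1.2 q.2.

Lemma DeltaA_UpsE p x y z : DeltaA p x y z = \sum_q sg p q * UpsE q x y z.
Proof. by have [_ DWp] := DW p.1.1 p.1.2 p.2; rewrite [LHS]DWp sum_triple. Qed.

(** The all-ones tensor is expanded twice: as the sum of all triangles of adjacency matrices, and as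
    n^2 times the star of trivial idempotents. Comparing coefficients makes t0 and n visible in
    [sigma]. *)
Lemma sum_sigma t0 q : E t0 = n%:R^-1 *: const_mx 1 ->
  \sum_p sg p q = (q == (t0, t0, t0))%:R * n%:R ^+ 2.
Proof.
move=> Et0.
have sumE x y z : \sum_q (\sum_p sg p q) * UpsE q x y z =
    \sum_q ((q == (t0, t0, t0))%:R * n%:R ^+ 2) * UpsE q x y z.
  transitivity (1 : C).
    rewrite -(sum_DeltaA x y z); under eq_bigr do rewrite mulr_suml.
    by rewrite exchange_big; apply: eq_bigr => p _; rewrite DeltaA_UpsE.
  under eq_bigr do rewrite -mulrA.
  by rewrite (sum_delta _ (fun q => n%:R ^+ 2 * UpsE q x y z)) UpsE_trivial.
(* Off the Krein-positive indices [sigma] vanishes by convention, and (t0, t0, t0) is not among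
   those, its tensor being nonzero. *)
have [kp|nkp] := boolp.pselect (krein_pos E q.1.1 q.1.2 q.2); first exact: (UpsE_coef sumE).
rewrite big1 => [|p _]; last by have [/(_ _ _ _ nkp)] := DW p.1.1 p.1.2 p.2.
case: eqP => [qt|]; last by rewrite mul0r.
case: nkp; rewrite qt /=; pose x := Ordinal n_gt0; apply: (@Ups_neq0_krein_pos _ _ _ x x x).
have := UpsE_trivial x x x Et0; rewrite /UpsE /=; apply: contra_eq_neq => ->.
by rewrite mulr0 eq_sym oner_neq0.
Qed.

(** Summing out the third leg of the triangle (A_i, A_i, I) gives A_i; doing the same in its star
    expansion keeps only r = s, t = t0. So these entries of [sigma] are the eigenvalues of A_i. *)
Lemma adjmx_sigma t0 i : E t0 = n%:R^-1 *: const_mx 1 ->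
  adjmx C rel i = \sum_r sigma i i ord0 r r t0 *: E r.
Proof.
move=> Et0; apply/matrixP=> x y; rewrite -sum_DeltaA_diag summxE.
under eq_bigr do rewrite DeltaA_UpsE.
rewrite exchange_big /=; under eq_bigr do rewrite -mulr_sumr (sum_Ups_idempotent _ _ _ _ _ Et0).
rewrite -(sum_triple (fun r s t => sg (i, i, ord0) (r, s, t) * (((t == t0) && (r == s))%:R * E r x y))).
apply: eq_bigr => r _; rewrite mxE.
rewrite -(sum_delta r (fun s => sigma i i ord0 r s t0 * E r x y)).
apply: eq_bigr => s _.
rewrite -(sum_delta t0 (fun t => (s == r)%:R * (sigma i i ord0 r s t * E r x y))).
by apply: eq_bigr => t _; rewrite /sg /= -mulnb natrM (eq_sym r); ring.
Qed.

Lemma Delta_bm a b c x y z :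
  Delta (bm a) (bm b) (bm c) x y z =
  \sum_p (a p.1.1 * b p.1.2 * c p.2) * DeltaA p x y z.
Proof.
rewrite -(sum_triple (fun i j k => (a i * b j * c k) *
  Delta (adjmx C rel i) (adjmx C rel j) (adjmx C rel k) x y z)) /Delta.
rewrite /bm !summxE !mulr_suml; apply: eq_bigr => i _.
rewrite -mulrA mulr_suml mulr_sumr; apply: eq_bigr => j _.
by rewrite mulr_sumr mulr_sumr; apply: eq_bigr => k _; rewrite !mxE; ring.
Qed.

Lemma Ups_lin (A B D : 'I_d.+1 -> 'M[C]_n) a b c x y z :
  Ups (\sum_i a i *: A i) (\sum_i b i *: B i) (\sum_i c i *: D i) x y z =
  \sum_(p : idx) (a p.1.1 * b p.1.2 * c p.2) * Ups (A p.1.1) (B p.1.2) (D p.2) x y z.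
Proof.
rewrite -(sum_triple (fun i j k => (a i * b j * c k) * Ups (A i) (B j) (D k) x y z)) /Ups.
under [RHS]eq_bigr do under eq_bigr do under eq_bigr do rewrite mulr_sumr.
under [RHS]eq_bigr do under eq_bigr do rewrite exchange_big.
under [RHS]eq_bigr do rewrite exchange_big; rewrite [RHS]exchange_big; apply: eq_bigr => u _ /=.
rewrite !summxE !mulr_suml; apply: eq_bigr => i _.
rewrite -mulrA mulr_suml mulr_sumr; apply: eq_bigr => j _.
by rewrite mulr_sumr mulr_sumr; apply: eq_bigr => k _; rewrite !mxE; ring.
Qed.

Lemma in_span_DeltaA t : in_span_of (@Delta C n) rel t ->
  exists T : idx -> C, forall x y z, t x y z = \sum_p T p * DeltaA p x y z.
Proof.
move=> [s [sBM tE]].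
suff [T TE] : exists T : idx -> C, forall x y z,
    \sum_(p <- s) p.1 * Delta p.2.1.1 p.2.1.2 p.2.2 x y z = \sum_p T p * DeltaA p x y z.
  by exists T => x y z; rewrite tE.
elim: s {tE} sBM => [|[k [[L M] N]] s IH] sBM.
  by exists (fun=> 0) => x y z; rewrite big_nil big1 // => p _; rewrite mul0r.
have [|T TE] := IH; first by move=> p ps; apply: sBM; rewrite inE ps orbT.
have [/= [a ->] [b ->] [c ->]] := sBM _ (mem_head _ _).
exists (fun p => k * (a p.1.1 * b p.1.2 * c p.2) + T p) => x y z.
rewrite big_cons TE /= Delta_bm mulr_sumr -big_split /=.
by apply: eq_bigr => p _; rewrite mulrA mulrDl.
Qed.

(** The conclusion mentions [sigma] and T but no scheme, so it can be read in any scheme with the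
    same [sigma]; [sigma_linverse_UpsE] turns it back into a tensor identity there. *)
Lemma sigma_linverse p (T : idx -> C) : krein_pos E p.1.1 p.1.2 p.2 ->
  (forall x y z, UpsE p x y z = \sum_q T q * DeltaA q x y z) ->
  forall p', \sum_q T q * sg q p' = (p' == p)%:R.
Proof.
move=> kp TE p'.
have [kp'|nkp'] := boolp.pselect (krein_pos E p'.1.1 p'.1.2 p'.2); last first.
  rewrite big1 => [|q _]; last first.
    by have [/(_ _ _ _ nkp')] := DW q.1.1 q.1.2 q.2; rewrite /sg => ->; rewrite mulr0.
  by case: eqP => // pp'; case: nkp'; rewrite pp'.
apply: (UpsE_coef (c := fun p' => \sum_q T q * sg q p') (c' := fun p' => (p' == p)%:R) _ kp').
move=> x y z; rewrite (sum_delta p (fun p => UpsE p x y z)) TE.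
under eq_bigr do rewrite mulr_suml.
rewrite exchange_big; apply: eq_bigr => q _; rewrite DeltaA_UpsE mulr_sumr.
by apply: eq_bigr => ? _; rewrite mulrA.
Qed.

Lemma sigma_linverse_UpsE p (T : idx -> C) :
  (forall p', \sum_q T q * sg q p' = (p' == p)%:R) ->
  forall x y z, UpsE p x y z = \sum_q T q * DeltaA q x y z.
Proof.
move=> TE x y z; rewrite -(sum_delta p (fun p => UpsE p x y z)).
under eq_bigr do rewrite -TE mulr_suml.
rewrite exchange_big; apply: eq_bigr => q _; rewrite DeltaA_UpsE mulr_sumr.
by apply: eq_bigr => ? _; rewrite mulrA.
Qed.

Lemma UpsE_DeltaA p : exactly_triply_regular C rel ->
  exists T : idx -> C, forall x y z, UpsE p x y z = \sum_q T q * DeltaA q x y z.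
Proof.
move=> [etr _]; apply: in_span_DeltaA; apply: etr.
exists [:: (1, (E p.1.1, E p.1.2, E p.2))]; split=> [q|x y z].
  by rewrite inE => /eqP ->; split; exact: E_inBM.
by rewrite big_seq1 /= mul1r.
Qed.

End BoseMesner.

(** * Structure constants common to two schemes with the same Delta-Wye parameters *)

Section TwoSchemes.
Variables (C : numClosedFieldType) (n m d : nat).
Variables (rel1 : 'I_n -> 'I_n -> 'I_d.+1) (rel2 : 'I_m -> 'I_m -> 'I_d.+1).
Variables (E1 : 'I_d.+1 -> 'M[C]_n) (E2 : 'I_d.+1 -> 'M[C]_m).
Hypothesis scheme1 : is_sym_assoc_scheme rel1.
Hypothesis scheme2 : is_sym_assoc_scheme rel2.
Hypothesis prim1 : is_prim_idempotents rel1 E1.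
Hypothesis prim2 : is_prim_idempotents rel2 E2.
Hypothesis etr1 : exactly_triply_regular C rel1.
Hypothesis etr2 : exactly_triply_regular C rel2.
Variable sigma : 'I_d.+1 -> 'I_d.+1 -> 'I_d.+1 -> 'I_d.+1 -> 'I_d.+1 -> 'I_d.+1 -> C.
Hypothesis DW1 : is_DeltaWye rel1 E1 sigma.
Hypothesis DW2 : is_DeltaWye rel2 E2 sigma.

(* The column sums of sigma locate the trivial idempotent and the order of the scheme. *)
Lemma same_trivial_idempotent : n = m /\
  exists t0, E1 t0 = n%:R^-1 *: const_mx 1 /\ E2 t0 = m%:R^-1 *: const_mx 1.
Proof.
have [t1 Et1] := trivial_idempotent scheme1 prim1.
have [t2 Et2] := trivial_idempotent scheme2 prim2.
have [n_gt0 _ _ _ _] := scheme1.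
(* This column sum is n^2, hence nonzero; computed in the second scheme it must then be m^2, with t1
   = t2. *)
have := sum_sigma scheme1 prim1 DW1 (t1, t1, t1) Et1.
rewrite (sum_sigma scheme2 prim2 DW2 (t1, t1, t1) Et2) eqxx mul1r.
case: eqP => [[t12 _ _]|_ /esym/eqP]; last first.
  by rewrite mul0r expf_eq0 /= pnatr_eq0 eqn0Ngt n_gt0.
rewrite mul1r => /eqP; rewrite -!natrX eqr_nat eqn_exp2r // => /eqP mn.
by split; [|exists t1; rewrite t12 in Et1 *].
Qed.

(** P consists of entries of [sigma], so it is common. Q is taken from the first scheme; the
    relation Q P = 1 involves scalars only and makes it valid in the second. *)
Lemma same_eigenmatrices : exists (P Q : 'I_d.+1 -> 'I_d.+1 -> C) t0,
  [/\ forall i, adjmx C rel1 i = \sum_r P i r *: E1 r,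
      forall i, adjmx C rel2 i = \sum_r P i r *: E2 r,
      forall r, E1 r = bm rel1 (Q r),
      forall r, E2 r = bm rel2 (Q r) &
      E1 t0 = n%:R^-1 *: const_mx 1 /\ E2 t0 = m%:R^-1 *: const_mx 1].
Proof.
have [_ [t0 [Et1 Et2]]] := same_trivial_idempotent.
pose P i r := sigma i i ord0 r r t0.
have P1 i := adjmx_sigma scheme1 prim1 DW1 i Et1.
have P2 i := adjmx_sigma scheme2 prim2 DW2 i Et2.
have [Q QE1] := idempotents_in_bm prim1.
exists P, Q, t0; split=> // r.
have QP : (fun s => \sum_i Q r i * P i s) =1 (fun s => (s == r)%:R).
  apply: (sumE_inj scheme1 prim1).
  transitivity (E1 r).
    rewrite QE1 /bm; under [RHS]eq_bigr do rewrite P1 scaler_sumr.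
    rewrite exchange_big; apply: eq_bigr => s _; rewrite scaler_suml.
    by apply: eq_bigr => i _; rewrite scalerA.
  rewrite (bigD1 r) //= eqxx scale1r big1 ?addr0 // => s /negbTE->.
  by rewrite scale0r.
rewrite /bm; under eq_bigr do rewrite P2 scaler_sumr.
rewrite exchange_big (bigD1 r) //= [X in _ + X]big1 => [|s /negbTE sr];
  under eq_bigr do rewrite scalerA; rewrite -scaler_suml QP.
  by rewrite eqxx scale1r addr0.
by rewrite sr scale0r.
Qed.

Lemma bm_pair_sumE : exists (P : 'I_d.+1 -> 'I_d.+1 -> C), forall c,
  bm rel1 c = \sum_r (\sum_i c i * P i r) *: E1 r /\
  bm rel2 c = \sum_r (\sum_i c i * P i r) *: E2 r.
Proof.
have [P [_ [_ [P1 P2 _ _ _]]]] := same_eigenmatrices.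
exists P => c; rewrite /bm; split.
  under eq_bigr do rewrite P1 scaler_sumr.
  rewrite exchange_big; apply: eq_bigr => s _; rewrite scaler_suml.
  by apply: eq_bigr => i _; rewrite scalerA.
under eq_bigr do rewrite P2 scaler_sumr.
rewrite exchange_big; apply: eq_bigr => s _; rewrite scaler_suml.
by apply: eq_bigr => i _; rewrite scalerA.
Qed.

(** That is, [kappa] is multiplicative: eigenvalues multiply pointwise, and the passage to
    eigenvalues and back is common to both schemes. *)
Lemma bm_pair_mul (c c' : 'I_d.+1 -> C) : exists c'',
  bm rel1 c *m bm rel1 c' = bm rel1 c'' /\ bm rel2 c *m bm rel2 c' = bm rel2 c''.
Proof.
have [P PE] := bm_pair_sumE; have [_ [Q [_ [_ _ Q1 Q2 _]]]] := same_eigenmatrices.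
have [-> ->] := PE c; have [-> ->] := PE c'.
rewrite (sumE_mul prim1) (sumE_mul prim2).
exists (fun j => \sum_r (\sum_i c i * P i r) * (\sum_i c' i * P i r) * Q r j).
by split; rewrite -bm_sum; apply: eq_bigr => r _; rewrite ?Q1 ?Q2.
Qed.

Lemma bm_pair_rowsum (c : 'I_d.+1 -> C) : exists rho,
  (forall x, \sum_y bm rel1 c x y = rho) /\ (forall x, \sum_y bm rel2 c x y = rho).
Proof.
have [P PE] := bm_pair_sumE; have [_ [_ [t0 [_ _ _ _ [Et1 Et2]]]]] := same_eigenmatrices.
exists (\sum_i c i * P i t0).
have rowsum (k : nat) (E : 'I_d.+1 -> 'M[C]_k) (rel : 'I_k -> 'I_k -> 'I_d.+1) :
    is_sym_assoc_scheme rel -> is_prim_idempotents rel E ->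
    E t0 = k%:R^-1 *: const_mx 1 ->
    bm rel c = \sum_r (\sum_i c i * P i r) *: E r ->
    forall x, \sum_y bm rel c x y = \sum_i c i * P i t0.
  move=> [k_gt0 _ _ _ _] prim Et0 cE x.
  have := sumE_mulE prim (fun r => \sum_i c i * P i r) t0; rewrite -cE Et0.
  rewrite -scalemxAr => /matrixP/(_ x x); rewrite !mxE mulr1 mulrC => /mulIf <-.
    by apply: eq_bigr => y _; rewrite mxE mulr1.
  by rewrite invr_eq0 pnatr_eq0 -lt0n.
by have [c1 c2] := PE c; split; [exact: (rowsum n E1)|exact: (rowsum m E2)].
Qed.

(** Krein-positivity belongs to a single scheme a priori. An inverse of [sigma] at p found in either
    scheme serves both; if p is Krein-positive in neither, both tensors vanish. *)
Lemma UpsE_pair p : exists T : idx d -> C,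
  (forall x y z, UpsE E1 p x y z = \sum_q T q * DeltaA C rel1 q x y z) /\
  (forall x y z, UpsE E2 p x y z = \sum_q T q * DeltaA C rel2 q x y z).
Proof.
have [k1|nk1] := boolp.pselect (krein_pos E1 p.1.1 p.1.2 p.2).
  have [T TE] := UpsE_DeltaA prim1 p etr1; exists T; split=> //.
  exact: sigma_linverse_UpsE DW2 _ _ (sigma_linverse scheme1 prim1 DW1 k1 TE).
have [k2|nk2] := boolp.pselect (krein_pos E2 p.1.1 p.1.2 p.2).
  have [T TE] := UpsE_DeltaA prim2 p etr2; exists T; split=> //.
  exact: sigma_linverse_UpsE DW1 _ _ (sigma_linverse scheme2 prim2 DW2 k2 TE).
exists (fun=> 0); split=> x y z; rewrite big1 => [|q _]; rewrite ?mul0r //; apply/eqP.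
  by apply: boolp.contrapT => /negP /(Ups_neq0_krein_pos scheme1 prim1).
by apply: boolp.contrapT => /negP /(Ups_neq0_krein_pos scheme2 prim2).
Qed.

Lemma Ups_bm_pair (c1 c2 c3 : 'I_d.+1 -> C) : exists T : idx d -> C,
  (forall x y z, Ups (bm rel1 c1) (bm rel1 c2) (bm rel1 c3) x y z =
                 \sum_q T q * DeltaA C rel1 q x y z) /\
  (forall x y z, Ups (bm rel2 c1) (bm rel2 c2) (bm rel2 c3) x y z =
                 \sum_q T q * DeltaA C rel2 q x y z).
Proof.
have [P PE] := bm_pair_sumE.
have [T TE] := fin_all_exists UpsE_pair.
pose c' c r := \sum_i c i * P i r.
exists (fun q => \sum_p (c' c1 p.1.1 * c' c2 p.1.2 * c' c3 p.2) * T p q).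
have [-> ->] := PE c1; have [-> ->] := PE c2; have [-> ->] := PE c3.
split=> x y z; rewrite Ups_lin; under [RHS]eq_bigr do rewrite mulr_suml.
  rewrite [RHS]exchange_big; apply: eq_bigr => p _; have [TE1 _] := TE p.
  by rewrite [Ups _ _ _ _ _ _]TE1 mulr_sumr; apply: eq_bigr => q _; rewrite mulrA.
rewrite [RHS]exchange_big; apply: eq_bigr => p _; have [_ TE2] := TE p.
by rewrite [Ups _ _ _ _ _ _]TE2 mulr_sumr; apply: eq_bigr => q _; rewrite mulrA.
Qed.

Lemma Delta_bm_pair (c1 c2 c3 : 'I_d.+1 -> C) : exists T : idx d -> C,
  (forall x y z, Delta (bm rel1 c1) (bm rel1 c2) (bm rel1 c3) x y z =
                 \sum_q T q * UpsA C rel1 q x y z) /\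
  (forall x y z, Delta (bm rel2 c1) (bm rel2 c2) (bm rel2 c3) x y z =
                 \sum_q T q * UpsA C rel2 q x y z).
Proof.
have [_ [Q [_ [_ _ Q1 Q2 _]]]] := same_eigenmatrices.
(* [sigma] expands a triangle into stars of idempotents, and Q rewrites each leg in adjacency
   matrices. *)
pose T1 p q := \sum_p' sg sigma p p' * (Q p'.1.1 q.1.1 * Q p'.1.2 q.1.2 * Q p'.2 q.2).
exists (fun q => \sum_p (c1 p.1.1 * c2 p.1.2 * c3 p.2) * T1 p q).
split=> x y z; rewrite Delta_bm; under [RHS]eq_bigr do rewrite mulr_suml.
  rewrite [RHS]exchange_big; apply: eq_bigr => p _; rewrite (DeltaA_UpsE DW1).
  under [RHS]eq_bigr do rewrite -mulrA; rewrite -mulr_sumr; congr (_ * _).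
  under [RHS]eq_bigr do rewrite mulr_suml; rewrite exchange_big; apply: eq_bigr => q _ /=.
  under [RHS]eq_bigr do rewrite -mulrA; rewrite -mulr_sumr; congr (_ * _).
  by rewrite /UpsE !Q1 Ups_lin.
rewrite [RHS]exchange_big; apply: eq_bigr => p _; rewrite (DeltaA_UpsE DW2).
under [RHS]eq_bigr do rewrite -mulrA; rewrite -mulr_sumr; congr (_ * _).
under [RHS]eq_bigr do rewrite mulr_suml; rewrite exchange_big; apply: eq_bigr => q _ /=.
under [RHS]eq_bigr do rewrite -mulrA; rewrite -mulr_sumr; congr (_ * _).
by rewrite /UpsE !Q2 Ups_lin.
Qed.

End TwoSchemes.

(** * Strand operators *)

Section KernelOperators.
Variables (C : comPzRingType) (T : finType).
Implicit Types K L : T -> T -> C.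

Definition op K : 'M[C]_#|T| := \matrix_(i, j) K (enum_val i) (enum_val j).

Lemma eq_op_kernel K L : K =2 L -> op K = op L.
Proof. by move=> KL; apply/matrixP=> i j; rewrite !mxE KL. Qed.

Lemma sum_enum_val (F : T -> C) : \sum_(i < #|T|) F (enum_val i) = \sum_t F t.
Proof. by rewrite [RHS](reindex (enum_val : 'I_#|T| -> T)) //; exact/onW_bij/enum_val_bij. Qed.

Lemma op_mul K L : op K * op L = op (fun s t => \sum_u K s u * L u t).
Proof.
apply/matrixP=> i j; rewrite !mxE -sum_enum_val.
by apply: eq_bigr => u _; rewrite !mxE.
Qed.

Lemma op_sum (J : finType) (K : J -> T -> T -> C) :
  \sum_j op (K j) = op (fun s t => \sum_j K j s t).
Proof. by apply/matrixP=> i j; rewrite summxE mxE; apply: eq_bigr => ? _; rewrite !mxE. Qed.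

Lemma mxtrace_op K : \tr (op K) = \sum_t K t t.
Proof. by rewrite -sum_enum_val; apply: eq_bigr => i _; rewrite mxE. Qed.

Lemma op_id : op (fun s t => (s == t)%:R) = 1.
Proof. by apply/matrixP=> i j; rewrite !mxE (inj_eq enum_val_inj). Qed.

Definition dop (f : T -> C) := op (fun s t => (s == t)%:R * f s).

Lemma dop_op f K : dop f * op K = op (fun s t => f s * K s t).
Proof.
rewrite op_mul; apply: eq_op_kernel => s t.
rewrite -(sum_delta s (fun u => f s * K u t)).
by apply: eq_bigr => u _; rewrite eq_sym mulrA.
Qed.

Lemma op_dop K f : op K * dop f = op (fun s t => K s t * f t).
Proof.
rewrite op_mul; apply: eq_op_kernel => s t.
rewrite -(sum_delta t (fun u => K s u * f u)).
by apply: eq_bigr => u _; ring.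
Qed.

Lemma eq_dop f g : f =1 g -> dop f = dop g.
Proof. by move=> fg; apply: eq_op_kernel => s t; rewrite fg. Qed.

Lemma dop_mul f g : dop f * dop g = dop (fun s => f s * g s).
Proof. by rewrite dop_op; apply: eq_op_kernel => s t; ring. Qed.

Lemma dop1 : dop (fun=> 1) = 1.
Proof. by rewrite -op_id; apply: eq_op_kernel => s t; rewrite mulr1. Qed.

End KernelOperators.

Section StrandOperators.
Variables (C : comPzRingType) (n : nat) (I : finType).
Local Notation T := {ffun I -> 'I_n}.

Definition upd (s : T) (j : I) (x : 'I_n) : T := [ffun i => if i == j then x else s i].

(** Decidable form of: s and t coincide away from strand j. *)
Definition agree (j : I) (s t : T) := upd s j (t j) == t.

Lemma upd_same (s : T) j x : upd s j x j = x.
Proof. by rewrite ffunE eqxx. Qed.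

Lemma upd_other (s : T) j x i : i != j -> upd s j x i = s i.
Proof. by rewrite ffunE => /negbTE->. Qed.

Lemma upd_id (s : T) j : upd s j (s j) = s.
Proof. by apply/ffunP=> i; rewrite ffunE; case: eqP => [->|]. Qed.

Lemma upd_upd s j x y : upd (upd s j x) j y = upd s j y.
Proof. by apply/ffunP=> i; rewrite !ffunE; case: eqP. Qed.

Lemma agree_upd s j x t : agree j (upd s j x) t = agree j s t.
Proof. by rewrite /agree upd_upd. Qed.

Lemma sum_agree s j (F : T -> C) : \sum_u (agree j s u)%:R * F u = \sum_x F (upd s j x).
Proof.
transitivity (\sum_(u | agree j s u) F u).
  by rewrite [RHS]big_mkcond; apply: eq_bigr => u _; case: agree; rewrite ?mul1r ?mul0r.
rewrite (reindex_onto (upd s j) (fun u => u j)) => [|u /eqP //].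
by apply: eq_bigl => x; rewrite /agree !upd_same !eqxx.
Qed.

(* the operator acting on strand j, with coefficients that may depend on the other strands *)
Definition lop j (k : T -> 'I_n -> C) := op (fun s t => (agree j s t)%:R * k s (t j)).

Definition bop j (M : 'M[C]_n) := lop j (fun s y => M (s j) y).
Definition aop i j (M : 'M[C]_n) := dop (fun s : T => M (s i) (s j)).

Lemma eq_lop j k k' : k =2 k' -> lop j k = lop j k'.
Proof. by move=> kk'; apply: eq_op_kernel => s t; rewrite kk'. Qed.

Lemma lop_mul j k k' :
  lop j k * lop j k' = lop j (fun s y => \sum_x k s x * k' (upd s j x) y).
Proof.
rewrite op_mul; apply: eq_op_kernel => s t.
under eq_bigr do rewrite -mulrA.
rewrite sum_agree mulr_sumr; apply: eq_bigr => x _.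
by rewrite upd_same agree_upd; ring.
Qed.

Lemma dop_lop f j k : dop f * lop j k = lop j (fun s y => f s * k s y).
Proof. by rewrite dop_op; apply: eq_op_kernel => s t; ring. Qed.

Lemma lop_dop f j k : lop j k * dop f = lop j (fun s y => k s y * f (upd s j y)).
Proof.
rewrite op_dop; apply: eq_op_kernel => s t; rewrite /agree.
by case: eqP => [->|_]; rewrite ?mul0r ?mulrA.
Qed.

Lemma lop_sum (J : finType) j (k : J -> T -> 'I_n -> C) :
  lop j (fun s y => \sum_p k p s y) = \sum_p lop j (k p).
Proof.
by rewrite op_sum; apply: eq_op_kernel => s t; rewrite mulr_sumr.
Qed.

Lemma dop_as_lop f j : dop f = lop j (fun s y => (s j == y)%:R * f s).
Proof.
apply: eq_op_kernel => s t; rewrite mulrA -natrM mulnb; congr ((nat_of_bool _)%:R * _).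
apply/idP/andP => [/eqP->|[/eqP + /eqP st]]; first by rewrite /agree upd_id !eqxx.
by rewrite -st upd_id => ->.
Qed.

Lemma bop_mul j M N : bop j M * bop j N = bop j (M *m N).
Proof.
rewrite lop_mul; apply: eq_lop => s y; rewrite mxE.
by apply: eq_bigr => x _; rewrite upd_same.
Qed.

Lemma bop1 j : bop j 1%:M = 1.
Proof.
rewrite -dop1 (dop_as_lop _ j); apply: eq_lop => s y.
by rewrite mxE mulr1.
Qed.

Lemma aop_mul i j M N : aop i j M * aop i j N = aop i j (\matrix_(x, y) (M x y * N x y)).
Proof. by rewrite dop_mul; apply: eq_dop => s; rewrite mxE. Qed.

Lemma aop1 i j : aop i j (const_mx 1) = 1.
Proof. by rewrite -dop1; apply: eq_dop => s; rewrite mxE. Qed.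

Lemma aop_comm i j i' j' M N : aop i j M * aop i' j' N = aop i' j' N * aop i j M.
Proof. by rewrite !dop_mul; apply: eq_dop => s; rewrite mulrC. Qed.

Lemma bop_dop_comm j M f : (forall s x, f (upd s j x) = f s) ->
  bop j M * dop f = dop f * bop j M.
Proof.
by move=> fj; rewrite lop_dop dop_lop; apply: eq_lop => s y; rewrite fj mulrC.
Qed.

Lemma bop_aop_comm j i i' M N : i != j -> i' != j ->
  bop j M * aop i i' N = aop i i' N * bop j M.
Proof. by move=> ij i'j; apply: bop_dop_comm => s x; rewrite !upd_other. Qed.

Lemma bop_comm i j M N : i != j -> bop i M * bop j N = bop j N * bop i M.
Proof.
have bb i' j' M' N' : i' != j' -> bop i' M' * bop j' N' =
    op (fun s t => (upd (upd s i' (t i')) j' (t j') == t)%:R * (M' (s i') (t i') * N' (s j') (t j'))).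
  move=> ij; have ji : j' != i' by rewrite eq_sym.
  rewrite op_mul; apply: eq_op_kernel => s t.
  under eq_bigr do rewrite -mulrA.
  rewrite sum_agree.
  rewrite -(sum_delta (t i') (fun x => (upd (upd s i' x) j' (t j') == t)%:R *
       (M' (s i') x * N' (s j') (t j')))); apply: eq_bigr => x _.
  rewrite upd_same (upd_other _ _ ji) /agree.
  case: (upd _ _ _ =P t) => [ut|]; rewrite ?mul0r ?mulr0 //.
  have -> : x = t i' by rewrite -ut upd_other // upd_same.
  by rewrite eqxx !mul1r.
move=> ij; have ji : j != i by rewrite eq_sym.
rewrite !bb //; apply: eq_op_kernel => s t; rewrite [M _ _ * _]mulrC.
congr ((_ == t)%:R * _); apply/ffunP=> l; rewrite !ffunE.
by case: (eqVneq l j) => [->|//]; rewrite (negbTE ji).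
Qed.

End StrandOperators.

(** * Star-triangle exchange and Markov property of strand operators *)

Section StarTriangle.
Variables (C : numClosedFieldType) (n : nat) (I : finType) (i j : I).
Hypothesis ij : i != j.
Local Notation T := {ffun I -> 'I_n}.
Local Notation lop := (@lop C n I).
Local Notation bop := (@bop C n I).
Local Notation aop := (@aop C n I).

(** The intermediate value of strand j is summed over and becomes the centre of a star whose legs
    end at the old value, the new value and the value of strand i. *)
Lemma bab_Ups (L M N : 'M[C]_n) : N^T = N ->
  bop j L * aop i j M * bop j N = lop j (fun s y => Ups L N M (s j) y (s i)).
Proof.
move=> Ns; rewrite lop_dop lop_mul; apply: eq_lop => s y; rewrite /Ups.
apply: eq_bigr => x _; rewrite !upd_same upd_other // -mulrA -mulrA; congr (_ * _).
by rewrite mulrC; congr (_ * _); rewrite -{1}Ns mxE.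
Qed.

(** Strand i is tied to both the old and the new value of strand j, and these to each other: a
    triangle. *)
Lemma aba_Delta (L M N : 'M[C]_n) : L^T = L -> N^T = N ->
  aop i j L * bop j M * aop i j N = lop j (fun s y => Delta L M N (s j) y (s i)).
Proof.
move=> Ls Ns; rewrite dop_lop lop_dop; apply: eq_lop => s y; rewrite /Delta.
by rewrite !upd_same upd_other // -{1}Ls -{1}Ns !mxE.
Qed.

(** The projections D a onto a fixed value of strand j commute with x, so cyclicity replaces
    [bop j M] by the sum of its compressions by D a, each being mu D a. *)
Lemma markov_bop (mu : C) (M : 'M[C]_n) (x : 'M[C]_#|T|) :
  (forall a, M a a = mu) ->
  (forall f : 'I_n -> C, x * dop (fun s : T => f (s j)) = dop (fun s : T => f (s j)) * x) ->
  \tr (bop j M * x) = mu * \tr x.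
Proof.
move=> Mdiag comm.
pose D a := dop (fun s : T => (s j == a)%:R : C).
have sumD : \sum_a D a = 1.
  rewrite op_sum -op_id; apply: eq_op_kernel => s t.
  rewrite -mulr_sumr (eq_bigr (fun a => (a == s j)%:R * 1)) => [|a _].
    by rewrite sum_delta mulr1.
  by rewrite mulr1 eq_sym.
have DD a : D a * D a = D a.
  by rewrite dop_mul; apply: eq_dop => s; case: eqP; rewrite ?mulr1 ?mulr0.
have DbD a : D a * bop j M * D a = mu *: D a.
  rewrite /D dop_lop lop_dop (dop_as_lop _ j); apply/matrixP=> p q; rewrite !mxE upd_same.
  case: (eqVneq (enum_val p j) a) => [->|_]; last by rewrite !(mul0r, mulr0).
  by case: (eqVneq (enum_val q j) a) => [->|qa]; rewrite ?Mdiag ?eqxx ?(eq_sym a) ?(negbTE qa) /= ?mulr1n ?mulr0n; ring.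
rewrite -[bop j M]mulr1 -sumD mulr_sumr mulr_suml raddf_sum /=.
rewrite -[x in RHS]mul1r -sumD mulr_suml raddf_sum mulr_sumr; apply: eq_bigr => a _ /=.
have Dx : D a * x = x * D a by rewrite [RHS](comm (fun x => (x == a)%:R)).
rewrite -{1}(DD a) mulrA -[_ * D a * x]mulrA [in LHS]Dx mulrA mxtrace_mulC -mxtraceZ.
have -> : mu *: (D a * x) = (mu *: D a) * x by exact: scalemxAl.
by rewrite -DbD !mulmxE !mulrA.
Qed.

(** Since x commutes with all operators on strand j, averaging over matrix units of that strand does
    not change the trace. The average sums M over the value of strand j, which gives the row sum;
    the n choices of the diagonal unit account for the factor n. *)
Lemma markov_aop (rho : C) (M : 'M[C]_n) (x : 'M[C]_#|T|) :
  (forall a, \sum_b M a b = rho) ->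
  (forall N, x * bop j N = bop j N * x) ->
  n%:R * \tr (aop i j M * x) = rho * \tr x.
Proof.
move=> Mrow comm.
have sumE : \sum_p bop j (delta_mx p p) = 1.
  rewrite -(bop1 _ _ j) -lop_sum; apply: eq_lop => s y.
  rewrite -summxE; congr (fun_of_matrix _ _ _).
  by apply/matrixP=> p q; rewrite summxE -[RHS]/(1%:M p q) mx1_sum_delta summxE.
have bb q p : bop j (delta_mx p q) * bop j (delta_mx q p) = bop j (delta_mx p p).
  by rewrite bop_mul mul_delta_mx.
have key q : \sum_p bop j (delta_mx q p) * aop i j M * bop j (delta_mx p q) =
    rho *: bop j (delta_mx q q).
  transitivity (lop j (fun s y => rho * (delta_mx q q : 'M[C]_n) (s j) y)); last first.
    by apply/matrixP=> s t; rewrite !mxE mulrCA.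
  under eq_bigr do rewrite lop_dop lop_mul.
  rewrite -lop_sum; apply: eq_lop => s y; rewrite -(Mrow (s i)) mulr_suml.
  apply: eq_bigr => p _.
  rewrite -(sum_delta p (fun x => M (s i) x * (delta_mx q q : 'M[C]_n) (s j) y)).
  apply: eq_bigr => z _; rewrite !upd_same upd_other // !mxE.
  by case: (z == p); case: (s j == q); case: (y == q); rewrite /= ?mulr1n ?mulr0n; ring.
have trq q : \tr (aop i j M * x) = rho * \tr (bop j (delta_mx q q) * x).
  rewrite -mxtraceZ.
  have -> : rho *: (bop j (delta_mx q q) * x) = (rho *: bop j (delta_mx q q)) * x.
    exact: scalemxAl.
  rewrite -key mulr_suml raddf_sum.
  rewrite -[aop i j M in LHS]mulr1 -sumE mulr_sumr mulr_suml raddf_sum; apply: eq_bigr => p _ /=.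
  rewrite -(bb q) mulrA -[_ * _ * x]mulrA -comm mulrA mxtrace_mulC.
  by rewrite !mulmxE !mulrA.
rewrite -[x in RHS]mul1r -sumE mulr_suml raddf_sum [in RHS]mulr_sumr.
rewrite (eq_bigr (fun q : 'I_n => \tr (aop i j M * x))) => [|q _]; last by rewrite /= -trq.
by rewrite sumr_const card_ord mulr_natl.
Qed.

End StarTriangle.

Lemma sum_pair (A B : nmodType) (J : finType) (f : J -> A) (g : J -> B) :
  (\sum_j f j, \sum_j g j) = \sum_j (f j, g j).
Proof.
apply: (big_rec3 (fun a b p => (a, b) = p)) => // j a b p _ <-.
by [].
Qed.

Lemma pair_mulE (A B : pzRingType) (a c : A) (b e : B) : (a, b) * (c, e) = (a * c, b * e).
Proof. by []. Qed.

Lemma sandwich_sum (A : pzRingType) (S T : A -> Prop) (J : finType) (F : J -> A) :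
  (forall j, sandwich S T (F j)) -> sandwich S T (\sum_j F j).
Proof.
by move=> ST; apply: big_ind => //; [exact: sandwich0 | exact: sandwichD].
Qed.

(** * Interleaved numbering of the generators on k + 1 strands *)

Section GridGenerators.
Variables (C : numClosedFieldType) (n k : nat).
Local Notation T := {ffun 'I_k.+1 -> 'I_n}.

(** The order is b_0, a_0, b_1, a_1, ..., b_k, which makes 2 k + 1 generators; those at distance two
    or more commute, neighbouring a's because they are diagonal. *)
Definition gop (i : nat) (M : 'M[C]_n) : 'M[C]_#|T| :=
  if odd i then aop (inord i./2) (inord i./2.+1) M else bop (inord i./2) M.

Lemma inord_neq a b : (a <= k)%N -> (b <= k)%N -> a != b -> (inord a : 'I_k.+1) != inord b.
Proof. by move=> ak bk; rewrite -val_eqE /= !inordK. Qed.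

Lemma gop_comm i j M N : (i.+1 < j)%N -> (j < k.*2.+1)%N ->
  gop i M * gop j N = gop j N * gop i M.
Proof.
move=> ij jk; rewrite /gop; case: ifP => oi; case: ifP => oj.
- exact: aop_comm.
- by rewrite bop_aop_comm //; apply: inord_neq; lia.
- by rewrite -bop_aop_comm //; apply: inord_neq; lia.
- by apply: bop_comm; apply: inord_neq; lia.
Qed.

Lemma gop_dop_comm i j M (f : 'I_n -> C) : (i < j.*2)%N -> (j <= k)%N ->
  gop i M * dop (fun s : T => f (s (inord j))) = dop (fun s : T => f (s (inord j))) * gop i M.
Proof.
move=> ij jk; rewrite /gop; case: ifP => oi.
  by rewrite !dop_mul; apply: eq_dop => s; rewrite mulrC.
rewrite bop_dop_comm // => s x; rewrite upd_other //.
by apply: inord_neq; lia.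
Qed.

Lemma gop_bop_comm i j M N : (i < j.*2.+1)%N -> (j < k)%N ->
  gop i M * bop (inord j.+1) N = bop (inord j.+1) N * gop i M.
Proof.
move=> ij jk; rewrite /gop; case: ifP => oi.
  by rewrite bop_aop_comm //; apply: inord_neq; lia.
by apply: bop_comm; apply: inord_neq; lia.
Qed.

Lemma aopC (i j : 'I_k.+1) (M : 'M[C]_n) : M^T = M -> aop i j M = aop j i M.
Proof. by move=> Ms; apply: eq_dop => s; rewrite -{1}Ms mxE. Qed.

End GridGenerators.

(** * Words in two schemes at once and the difference of their traces *)

Section PairTrace.
Variables (C : numClosedFieldType) (n d k : nat).
Variables (rel1 rel2 : 'I_n -> 'I_n -> 'I_d.+1).
Hypothesis scheme1 : is_sym_assoc_scheme rel1.
Hypothesis scheme2 : is_sym_assoc_scheme rel2.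
Local Notation coef := ('I_d.+1 -> C).
Hypothesis pair_mul : forall c c' : coef, exists c'' : coef,
  bm rel1 c *m bm rel1 c' = bm rel1 c'' /\ bm rel2 c *m bm rel2 c' = bm rel2 c''.
Hypothesis pair_rowsum : forall c : coef, exists rho,
  (forall x, \sum_y bm rel1 c x y = rho) /\ (forall x, \sum_y bm rel2 c x y = rho).
Hypothesis pair_Ups : forall c1 c2 c3 : coef, exists T : idx d -> C,
  (forall x y z, Ups (bm rel1 c1) (bm rel1 c2) (bm rel1 c3) x y z =
                 \sum_q T q * DeltaA C rel1 q x y z) /\
  (forall x y z, Ups (bm rel2 c1) (bm rel2 c2) (bm rel2 c3) x y z =
                 \sum_q T q * DeltaA C rel2 q x y z).
Hypothesis pair_Delta : forall c1 c2 c3 : coef, exists T : idx d -> C,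
  (forall x y z, Delta (bm rel1 c1) (bm rel1 c2) (bm rel1 c3) x y z =
                 \sum_q T q * UpsA C rel1 q x y z) /\
  (forall x y z, Delta (bm rel2 c1) (bm rel2 c2) (bm rel2 c3) x y z =
                 \sum_q T q * UpsA C rel2 q x y z).

Local Notation A := ('M[C]_#|{ffun 'I_k.+1 -> 'I_n}| * 'M[C]_#|{ffun 'I_k.+1 -> 'I_n}|)%type.

Definition gen (i : nat) (x : A) : Prop :=
  exists c : coef, x = (gop k i (bm rel1 c), gop k i (bm rel2 c)).

(** The argument a carries a scalar inside a generator, as sandwiches admit no separate scalars. *)
Definition delta_coef (a : C) (i : 'I_d.+1) : coef := fun l => a * (l == i)%:R.

Lemma bm_delta_coef (rel : 'I_n -> 'I_n -> 'I_d.+1) a i :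
  bm rel (delta_coef a i) = a *: adjmx C rel i.
Proof. by apply/matrixP=> x y; rewrite bmE !mxE. Qed.

Lemma aba_bab (rel : 'I_n -> 'I_n -> 'I_d.+1) (i j : 'I_k.+1) (c1 c2 c3 : coef)
    (T : idx d -> C) :
  is_sym_assoc_scheme rel -> i != j ->
  (forall x y z, Delta (bm rel c1) (bm rel c2) (bm rel c3) x y z =
                 \sum_q T q * UpsA C rel q x y z) ->
  aop i j (bm rel c1) * bop j (bm rel c2) * aop i j (bm rel c3) =
  \sum_(q : idx d) bop j (bm rel (delta_coef (T q) q.1.1)) *
    aop i j (bm rel (delta_coef 1 q.2)) * bop j (bm rel (delta_coef 1 q.1.2)).
Proof.
move=> scheme ij TE; rewrite aba_Delta ?bm_sym //.
under [RHS]eq_bigr do rewrite bab_Ups ?bm_sym //.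
rewrite -lop_sum; apply: eq_lop => s y; rewrite TE; apply: eq_bigr => q _.
rewrite !bm_delta_coef !scale1r /UpsA /Ups mulr_sumr.
by apply: eq_bigr => u _; rewrite !mxE; ring.
Qed.

Lemma bab_aba (rel : 'I_n -> 'I_n -> 'I_d.+1) (i j : 'I_k.+1) (c1 c2 c3 : coef)
    (T : idx d -> C) :
  is_sym_assoc_scheme rel -> i != j ->
  (forall x y z, Ups (bm rel c1) (bm rel c2) (bm rel c3) x y z =
                 \sum_q T q * DeltaA C rel q x y z) ->
  bop j (bm rel c1) * aop i j (bm rel c3) * bop j (bm rel c2) =
  \sum_(q : idx d) aop i j (bm rel (delta_coef (T q) q.1.1)) *
    bop j (bm rel (delta_coef 1 q.1.2)) * aop i j (bm rel (delta_coef 1 q.2)).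
Proof.
move=> scheme ij TE; rewrite bab_Ups ?bm_sym //.
under [RHS]eq_bigr do rewrite aba_Delta ?bm_sym //.
rewrite -lop_sum; apply: eq_lop => s y; rewrite TE; apply: eq_bigr => q _.
by rewrite !bm_delta_coef !scale1r /DeltaA /Delta !mxE; ring.
Qed.

(** As a's and b's alternate, odd i needs star to triangle and even i triangle to star; both
    inclusions of exact triple regularity enter here. *)
Lemma gen_braid i x y z : (i.+1 < k.*2.+1)%N ->
  gen i.+1 x -> gen i y -> gen i.+1 z -> sandwich (gen i) (gen i.+1) (x * y * z).
Proof.
move=> ik [c1 ->] [c2 ->] [c3 ->]; rewrite /gop /=; case: ifP => oi; last first.
  have oi' : odd i by rewrite -[odd i]negbK oi.
  have -> : uphalf i = i./2.+1 by lia.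
  have ij : (inord i./2 : 'I_k.+1) != inord i./2.+1 by apply: inord_neq; lia.
  have [T [T1 T2]] := pair_Ups c1 c3 c2.
  rewrite oi' !pair_mulE.
  rewrite (bab_aba scheme1 ij T1) (bab_aba scheme2 ij T2) sum_pair.
  apply: sandwich_sum => q; rewrite -!pair_mulE; apply: sandwich_in.
  - by exists (delta_coef (T q) q.1.1); rewrite /gop oi'.
  - by exists (delta_coef 1 q.1.2); rewrite /gop /= oi' uphalfE; congr (bop (inord _) _, bop (inord _) _); lia.
  - by exists (delta_coef 1 q.2); rewrite /gop oi'.
have ij : (inord i./2.+1 : 'I_k.+1) != inord i./2 by apply: inord_neq; lia.
have -> : uphalf i = i./2 by lia.
have [T [T1 T2]] := pair_Delta c1 c2 c3.
rewrite (negbTE oi) !pair_mulE.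
(* Here b acts on the left strand of a, so a is flipped to make that strand its second one. *)
rewrite !(aopC (inord i./2) _ (bm_sym scheme1 _)) !(aopC (inord i./2) _ (bm_sym scheme2 _)).
rewrite (aba_bab scheme1 ij T1) (aba_bab scheme2 ij T2) sum_pair.
apply: sandwich_sum => q; rewrite -!pair_mulE; apply: sandwich_in.
- by exists (delta_coef (T q) q.1.1); rewrite /gop (negbTE oi).
- exists (delta_coef 1 q.2); rewrite /gop /= oi.
  rewrite !(aopC (inord i./2.+1) _ (bm_sym scheme1 _)) !(aopC (inord i./2.+1) _ (bm_sym scheme2 _)).
  by congr (aop (inord _) (inord _) _, aop (inord _) (inord _) _); lia.
- by exists (delta_coef 1 q.1.2); rewrite /gop (negbTE oi).
Qed.

(** The Markov multipliers, rho / n for a's and the diagonal entry for b's, depend only on the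
    coefficients, so they agree in both components and factor out of the difference. *)
Lemma gen_markov m g x : (m < k.*2.+1)%N -> gen m g -> gen_alg gen m x ->
  exists c, \tr (g * x).1 - \tr (g * x).2 = c * (\tr x.1 - \tr x.2).
Proof.
move=> mk [c ->] hx; rewrite /gop; case: ifP => om.
  have [rho [rho1 rho2]] := pair_rowsum c; exists (n%:R^-1 * rho).
  have comm N : x * (bop (inord m./2.+1) N, bop (inord m./2.+1) N) =
      (bop (inord m./2.+1) N, bop (inord m./2.+1) N) * x.
    apply: gen_alg_comm hx => i _ im [a ->].
    by rewrite !pair_mulE !gop_bop_comm //; lia.
  have ij : (inord m./2 : 'I_k.+1) != inord m./2.+1 by apply: inord_neq; lia.
  have n0 : n%:R != 0 :> C by have [+ _ _ _ _] := scheme1; rewrite pnatr_eq0 lt0n.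
  rewrite mulrBr -!mulrA.
  rewrite -(@markov_aop C n _ _ _ ij rho (bm rel1 c) x.1) //; last first.
    by move=> N; have := congr1 fst (comm N).
  rewrite -(@markov_aop C n _ _ _ ij rho (bm rel2 c) x.2) //; last first.
    by move=> N; have := congr1 snd (comm N).
  by rewrite !mulrA mulVf // !mul1r.
exists (c ord0).
have comm f : let D := dop (fun s : {ffun 'I_k.+1 -> 'I_n} => f (s (inord m./2))) in
    x * (D, D) = (D, D) * x.
  apply: gen_alg_comm hx => i _ im [a ->].
  by rewrite !pair_mulE !gop_dop_comm //; lia.
rewrite mulrBr.
rewrite -(@markov_bop C n _ (inord m./2) (c ord0) (bm rel1 c) x.1); first last.
- by move=> f; have := congr1 fst (comm f).
- by move=> a; rewrite bmE rel_diag.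
rewrite -(@markov_bop C n _ (inord m./2) (c ord0) (bm rel2 c) x.2) //.
- by move=> a; rewrite bmE rel_diag.
- by move=> f; have := congr1 snd (comm f).
Qed.

Lemma gen_alg_trace x : gen_alg gen k.*2.+1 x -> \tr x.1 = \tr x.2.
Proof.
move=> hx; apply/eqP; rewrite -subr_eq0; apply/eqP.
apply: (@markov_trace_eq0 A gen k.*2.+1 _ _ _ _ C (fun x => \tr x.1 - \tr x.2)) hx => //=.
- move=> i ik; rewrite /gen /gop; case: (odd i).
    by exists (fun=> 1); rewrite !bm_const1 !aop1.
  by exists (fun i => (i == ord0)%:R); rewrite !bm_id // !bop1.
- move=> i _ _ ik [c ->] [c' ->]; rewrite /gen /gop; case: (odd i).
    exists (fun i => c i * c' i); rewrite -!schur_bm.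
    by rewrite !pair_mulE !aop_mul.
  have [c'' [c1 c2]] := pair_mul c c'; exists c''; rewrite -c1 -c2.
  by rewrite !pair_mulE !bop_mul.
- move=> i j _ _ ij jk [c ->] [c' ->].
  by rewrite !pair_mulE !(@gop_comm C n k i j).
- exact: gen_braid.
- by rewrite !linear0 subrr.
- by move=> a b; rewrite !linearD /=; ring.
- by move=> a b; rewrite mxtrace_mulC [X in _ - X = _]mxtrace_mulC.
- by rewrite subrr.
- exact: gen_markov.
Qed.

End PairTrace.

(** * Grid partition functions as traces *)

Section PathSum.
Variables (C : comPzRingType) (T : finType) (K : nat -> T -> T -> C).

Fixpoint path_kernel (R : nat) : T -> T -> C :=
  if R is R'.+1 then fun s t => \sum_u path_kernel R' s u * K R' u t
  else fun s t => (s == t)%:R.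

Lemma prod_op R : \prod_(r < R) op (K r) = op (path_kernel R).
Proof.
elim: R => [|R IH]; first by rewrite big_ord0 op_id.
by rewrite big_ord_recr /= IH op_mul.
Qed.

Definition snoc_ffun R (pt : {ffun 'I_R.+1 -> T} * T) : {ffun 'I_R.+2 -> T} :=
  [ffun i : 'I_R.+2 => if (i <= R)%N then pt.1 (inord i) else pt.2].

Lemma path_sum R (g : T -> T -> C) :
  \sum_(P : {ffun 'I_R.+1 -> T})
     (\prod_(r < R) K r (P (inord r)) (P (inord r.+1))) * g (P ord0) (P ord_max) =
  \sum_s \sum_t path_kernel R s t * g s t.
Proof.
elim: R g => [|R IH] g.
  rewrite [RHS](eq_bigr (fun s => g s s)) => [|s _]; last first.
    by rewrite -(sum_delta s (g s)); apply: eq_bigr => t _; rewrite eq_sym.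
  rewrite (reindex (fun s : T => [ffun=> s] : {ffun 'I_1 -> T})) /=.
    by apply: eq_bigr => s _; rewrite big_ord0 mul1r !ffunE.
  exists (fun P : {ffun 'I_1 -> T} => P ord0) => [s _|P _]; first by rewrite ffunE.
  by apply/ffunP=> i; rewrite ffunE (ord1 i).
rewrite (reindex (@snoc_ffun R)) /=; last first.
  exists (fun P : {ffun 'I_R.+2 -> T} => ([ffun i : 'I_R.+1 => P (inord i)], P ord_max)).
    move=> [P t] _; rewrite /snoc_ffun; congr pair; last by rewrite ffunE /= ltnn.
    apply/ffunP=> i; rewrite !ffunE /=.
    have lti : (i < R.+2)%N by rewrite (leq_trans (ltn_ord i)).
    by rewrite (inordK lti) -ltnS ltn_ord inord_val.
  move=> P _; apply/ffunP=> i; rewrite !ffunE /=; case: leqP => iR.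
    by rewrite inordK ?inord_val.
  congr (P _); apply/val_inj => /=; have := ltn_ord i; lia.
rewrite -(pair_bigA _ (fun P t => (\prod_(r < R.+1) K r (snoc_ffun (P, t) (inord r))
   (snoc_ffun (P, t) (inord r.+1))) * g (snoc_ffun (P, t) ord0) (snoc_ffun (P, t) ord_max))) /=.
have := IH (fun s u => \sum_t K R u t * g s t).
rewrite (_ : \sum_s \sum_t _ = \sum_s \sum_t (\sum_u path_kernel R s u * K R u t) * g s t).
  move=> <-; apply: eq_bigr => P _; rewrite mulr_sumr; apply: eq_bigr => t _.
  rewrite big_ord_recr /= -!mulrA; congr (_ * (_ * _)).
  - apply: eq_bigr => r _.
    by rewrite !ffunE !inordK; last (have := ltn_ord r; lia); first (rewrite !ifT //; have := ltn_ord r; lia); have := ltn_ord r; lia.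
  - rewrite !ffunE !inordK ?leqnn ?ltnn //.
    by congr (K _ (P _) _); apply/val_inj; rewrite /= inordK.
  - rewrite !ffunE /= ltnn; congr (g (P _) _).
    by apply/val_inj; rewrite /= inordK.
apply: eq_bigr => s _; under [RHS]eq_bigr do rewrite mulr_suml.
rewrite exchange_big; apply: eq_bigr => u _ /=; rewrite mulr_sumr.
by apply: eq_bigr => t _; rewrite mulrA.
Qed.

Lemma trace_prod_op R :
  \tr (\prod_(r < R.+1) op (K r)) =
  \sum_(P : {ffun 'I_R.+1 -> T}) \prod_(r < R.+1) K r (P r) (P (inord r.+1)).
Proof.
rewrite big_ord_recr /= prod_op op_mul mxtrace_op.
rewrite -(path_sum R (fun s t => K R t s)); apply: eq_bigr => P _.
rewrite big_ord_recr /=; congr (_ * _).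
  apply: eq_bigr => r _; congr (K _ (P _) _); apply/val_inj; rewrite /= inordK //.
  by have := ltn_ord r; lia.
(* At r = R the index r + 1 is out of range and [inord] returns 0, which closes the path into a
   cycle. *)
congr (K _ _ (P _)); apply/val_inj; rewrite /inord /insubd insubF //=.
by rewrite ltnn.
Qed.

End PathSum.

Lemma prod_bop (C : comPzRingType) (n : nat) (I : finType) (M : I -> 'M[C]_n) :
  \prod_i bop i (M i) = op (fun s t : {ffun I -> 'I_n} => \prod_i M i (s i) (t i)).
Proof.
(* Induction over duplicate-free lists of strands; the strands not yet listed carry the identity
   kernel. *)
suff H (r : seq I) : uniq r -> \prod_(i <- r) bop i (M i) =
    op (fun s t : {ffun I -> 'I_n} => \prod_i (if i \in r then M i (s i) (t i) else (s i == t i)%:R)).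
  rewrite H ?index_enum_uniq //; apply: eq_op_kernel => s t.
  by apply: eq_bigr => i _; rewrite mem_index_enum.
elim: r => [_|j r IH /= /andP[jr ur]].
  rewrite big_nil -op_id; apply: eq_op_kernel => s t.
  case: (eqVneq s t) => [->|st]; first by rewrite big1 // => i _; rewrite eqxx.
  have [i /negbTE sti] : exists i, s i != t i.
    apply/existsP; rewrite -[[exists _, _]]negbK negb_exists; apply: contra st => /forallP st.
    by apply/eqP/ffunP=> i; apply/eqP; rewrite -[_ == _]negbK.
  by rewrite (bigD1 i) //= sti mul0r.
rewrite big_cons IH // op_mul; apply: eq_op_kernel => s t.
under [LHS]eq_bigr do rewrite -mulrA.
rewrite sum_agree (bigD1 j) //= mem_head.
rewrite -(sum_delta (t j) (fun x => M j (s j) x * _)); apply: eq_bigr => x _.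
rewrite upd_same mulrCA; congr (_ * _).
rewrite (bigD1 j) //= (negbTE jr) upd_same; congr (_ * _).
by apply: eq_bigr => i ij; rewrite upd_other // inE (negbTE ij).
Qed.

Lemma prod_aop (C : comPzRingType) (n : nat) (I : finType) (J : finType)
    (a b : J -> I) (M : J -> 'M[C]_n) :
  \prod_l aop (a l) (b l) (M l) =
  dop (fun s : {ffun I -> 'I_n} => \prod_l M l (s (a l)) (s (b l))).
Proof.
elim: (index_enum J) => [|l r IH].
  by rewrite big_nil -dop1; apply: eq_dop => s; rewrite big_nil.
by rewrite big_cons IH dop_mul; apply: eq_dop => s; rewrite big_cons.
Qed.

Lemma prod_pair (A B : pzRingType) (J : finType) (f : J -> A) (g : J -> B) :
  (\prod_j f j, \prod_j g j) = \prod_j (f j, g j).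
Proof. by apply: (big_rec3 (fun a b p => (a, b) = p)) => // j a b p _ <-. Qed.

Lemma gen_alg_prod (A : pzRingType) (G : nat -> A -> Prop) m (J : finType) (F : J -> A) :
  (forall j, gen_alg G m (F j)) -> gen_alg G m (\prod_j F j).
Proof. by move=> GF; apply: big_ind => //; [exact: gen_alg1|exact: gen_algM]. Qed.

(** * Transfer matrices of a grid closed up vertically *)

Section Cylinder.
Variables (C : numClosedFieldType) (n d k R : nat).
Local Notation coef := ('I_d.+1 -> C).
Local Notation pixel := ('I_R.+1 * 'I_k.+1)%type.

(** Beyond the last column or row [inord] gives 0, so both successors are cyclic. *)
Definition right_px (p : pixel) : pixel := (p.1, inord p.2.+1).
Definition down_px (p : pixel) : pixel := (inord p.1.+1, p.2).

Definition cylinder_sum (rel : 'I_n -> 'I_n -> 'I_d.+1) (H V : pixel -> coef) : C :=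
  \sum_(psi : {ffun pixel -> 'I_n})
    \prod_p (bm rel (H p) (psi p) (psi (right_px p)) * bm rel (V p) (psi p) (psi (down_px p))).

Definition cylinder_word rel (H V : pixel -> coef) : 'M[C]_#|{ffun 'I_k.+1 -> 'I_n}| :=
  \prod_(r < R.+1) ((\prod_(i < k.+1) aop i (inord i.+1) (bm rel (H (r, i)))) *
                    (\prod_(i < k.+1) bop i (bm rel (V (r, i))))).

Lemma trace_cylinder_word rel H V :
  \tr (cylinder_word rel H V) = cylinder_sum rel H V.
Proof.
pose K (r : nat) (s t : {ffun 'I_k.+1 -> 'I_n}) : C :=
  (\prod_(i < k.+1) bm rel (H (inord r, i)) (s i) (s (inord i.+1))) *
  (\prod_(i < k.+1) bm rel (V (inord r, i)) (s i) (t i)).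
have -> : cylinder_word rel H V = \prod_(r < R.+1) op (K r).
  apply: eq_bigr => r _; rewrite prod_aop prod_bop dop_op.
  by apply: eq_op_kernel => s t; rewrite /K inord_val.
rewrite trace_prod_op /cylinder_sum.
rewrite (reindex (fun P : {ffun 'I_R.+1 -> {ffun 'I_k.+1 -> 'I_n}} =>
   [ffun p : pixel => P p.1 p.2])) /=; last first.
  exists (fun psi : {ffun pixel -> 'I_n} => [ffun r => [ffun i => psi (r, i)]]) => [P _|psi _].
    by apply/ffunP=> r; apply/ffunP=> i; rewrite !ffunE.
  by apply/ffunP=> -[r i]; rewrite !ffunE.
apply: eq_bigr => P _.
transitivity (\prod_(r < R.+1) \prod_(i < k.+1)
    (bm rel (H (r, i)) (P r i) (P r (inord i.+1)) *
     bm rel (V (r, i)) (P r i) (P (inord r.+1) i))).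
  by apply: eq_bigr => r _; rewrite /K inord_val -big_split.
by rewrite pair_bigA; apply: eq_bigr => -[r i] _; rewrite !ffunE.
Qed.

(** The factor joining strand k to strand 0 is not one of the generators; constant weight 1 in the
    last column turns it into the identity. *)
Lemma cylinder_word_gen (rel1 rel2 : 'I_n -> 'I_n -> 'I_d.+1) H V :
  (forall p : pixel, p.2 = k :> nat -> H p =1 (fun=> 1)) ->
  gen_alg (gen (k := k) rel1 rel2) k.*2.+1 (cylinder_word rel1 H V, cylinder_word rel2 H V).
Proof.
move=> Hk; rewrite prod_pair; apply: gen_alg_prod => r; rewrite -pair_mulE.
apply: gen_algM; rewrite prod_pair; apply: gen_alg_prod => i.
  have [ik|ik] := ltnP i k.
    apply: (@gen_alg_gen _ _ _ i.*2.+1); first by lia.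
    exists (H (r, i)); rewrite /gop /= odd_double /= uphalf_double.
    by rewrite inord_val.
  have {}ik : i = k :> nat by have := ltn_ord i; lia.
  rewrite !(eq_bm _ (Hk (r, i) ik)) !bm_const1 !aop1; exact: gen_alg1.
apply: (@gen_alg_gen _ _ _ i.*2); first by have := ltn_ord i; lia.
by exists (V (r, i)); rewrite /gop odd_double doubleK inord_val.
Qed.

End Cylinder.

(** * Scaffolds of grid minors *)

Section GridMinor.
Variables (V Ed : finType) (ends : Ed -> V * V) (R k : nat).
Local Notation pixel := ('I_R.+1 * 'I_k.+1)%type.
(* a slot (p, true) is the link from p to its right neighbour, (p, false) the link downwards *)
Local Notation slot := (pixel * bool)%type.

Definition next_pixel (s : slot) : pixel := if s.2 then right_px s.1 else down_px s.1.
Definition valid_slot (s : slot) := if s.2 then (s.1.2 < k)%N else (s.1.1 < R)%N.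
Definition pixel_step (p q : pixel) := [exists b, valid_slot (p, b) && (next_pixel (p, b) == q)].

(** [lab] names the branch set of a pixel, [None] meaning none. Loops are ignored and parallel edges
    may use the same link, so the minor is that of the underlying simple graph. *)
Definition grid_minor (lab : pixel -> option V) : Prop :=
  [/\ forall v, exists p, lab p = Some v,
      forall p q v, lab p = Some v -> lab q = Some v ->
        connect [rel p q | (lab p == lab q) && (pixel_step p q || pixel_step q p)] p q &
      forall e, (ends e).1 != (ends e).2 -> exists p q,
        [/\ lab p = Some (ends e).1, lab q = Some (ends e).2 & pixel_step p q || pixel_step q p]].

Variable lab : pixel -> option V.
Hypothesis lab_minor : grid_minor lab.

Definition slot_of_edge (o : option slot) (e : Ed) : Prop :=
  if o is Some s then valid_slot s /\
    ((lab s.1 = Some (ends e).1 /\ lab (next_pixel s) = Some (ends e).2) \/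
     (lab s.1 = Some (ends e).2 /\ lab (next_pixel s) = Some (ends e).1))
  else (ends e).1 = (ends e).2.

Lemma choose_slots : exists ch : Ed -> option slot, forall e, slot_of_edge (ch e) e.
Proof.
have [_ _ edges] := lab_minor.
apply: (@fin_all_exists _ _ (fun e o => slot_of_edge o e)) => e; case: (eqVneq (ends e).1 (ends e).2) => [ee|ne].
  by exists None.
have [p [q [lp lq /orP[/existsP[b /andP[vb /eqP nb]]|/existsP[b /andP[vb /eqP nb]]]]]] := edges e ne.
  by exists (Some (p, b)); split=> //; left; rewrite nb.
by exists (Some (q, b)); split=> //; right; rewrite nb.
Qed.

Variable ch : Ed -> option slot.
Hypothesis chP : forall e, slot_of_edge (ch e) e.

Definition glued (s : slot) := (lab s.1 == lab (next_pixel s)) && (lab s.1 != None).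

Section Weights.
Variables (C : numClosedFieldType) (d : nat) (c : Ed -> 'I_d.+1 -> C).

(** Contracted links carry I, all others J, multiplied entrywise by the weights of all edges hosted
    by the link. *)
Definition slot_weight (s : slot) : 'I_d.+1 -> C :=
  if valid_slot s then
    fun l => (if glued s then (l == ord0)%:R else 1) * \prod_(e | ch e == Some s) c e l
  else fun=> 1.

Variables (n : nat) (rel : 'I_n -> 'I_n -> 'I_d.+1).
Hypothesis scheme : is_sym_assoc_scheme rel.

Let w e := bm rel (c e).
Let edge_factor (psi : {ffun pixel -> 'I_n}) e : C :=
  if ch e is Some s then w e (psi s.1) (psi (next_pixel s)) else 1.
Let compat (psi : {ffun pixel -> 'I_n}) :=
  [forall s, valid_slot s && glued s ==> (psi s.1 == psi (next_pixel s))].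

Lemma slot_weightE s x y : valid_slot s ->
  bm rel (slot_weight s) x y =
  (if glued s then (x == y)%:R else 1) * \prod_(e | ch e == Some s) w e x y.
Proof.
case: scheme => _ rel0 _ _ _ vs; rewrite bmE /slot_weight vs; congr (_ * _).
  by rewrite rel0.
by apply: eq_bigr => e _; rewrite /w bmE.
Qed.

Lemma cylinder_term (psi : {ffun pixel -> 'I_n}) :
  \prod_p (bm rel (slot_weight (p, true)) (psi p) (psi (right_px p)) *
           bm rel (slot_weight (p, false)) (psi p) (psi (down_px p))) =
  (compat psi)%:R * \prod_e edge_factor psi e.
Proof.
transitivity (\prod_(s : slot) bm rel (slot_weight s) (psi s.1) (psi (next_pixel s))).
  rewrite -(pair_bigA _ (fun p b => bm rel (slot_weight (p, b)) (psi p) (psi (next_pixel (p, b))))).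
  by apply: eq_bigr => p _; rewrite big_bool.
transitivity ((\prod_(s | valid_slot s) (if glued s then (psi s.1 == psi (next_pixel s))%:R else 1)) *
   \prod_(s | valid_slot s) \prod_(e | ch e == Some s) w e (psi s.1) (psi (next_pixel s)) : C).
  rewrite -big_split /= [RHS]big_mkcond; apply: eq_bigr => s _.
  case: ifP => vs; first by rewrite slot_weightE.
  by rewrite bmE /slot_weight vs.
congr (_ * _).
  case: (boolP (compat psi)) => [/forallP cp|]; first rewrite big1 // => s vs.
    by have := cp s; rewrite vs /=; case: glued => //= /eqP->; rewrite eqxx.
  rewrite negb_forall => /existsP[s]; rewrite negb_imply => /andP[/andP[vs gs] /negbTE ns].
  by rewrite (bigD1 s) //= gs ns mul0r.
rewrite (exchange_big_dep predT) //=; apply: eq_bigr => e _; rewrite /edge_factor.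
have := chP e; case: (ch e) => [s /= [vs _]|_]; last first.
  by rewrite big_pred0 // => s; rewrite andbF.
rewrite (big_pred1 s) // => s'; rewrite /= (inj_eq (@Some_inj _)) eq_sym.
by case: eqP => [->|]; rewrite ?andbF ?vs.
Qed.

Lemma compat_lab (psi : {ffun pixel -> 'I_n}) p q v : compat psi ->
  lab p = Some v -> lab q = Some v -> psi p = psi q.
Proof.
have [_ conn _] := lab_minor; move=> /forallP cp lp lq.
have /connectP[path] := conn p q v lp lq; elim: path p lp => [|p' path IH] p lp /=.
  by move=> _ ->.
move=> /andP[/andP[/eqP lpp' st] pth] qE.
have step p1 p2 : lab p1 = Some v -> lab p1 = lab p2 -> pixel_step p1 p2 -> psi p1 = psi p2.
  move=> l1 l12 /existsP[b /andP[vb /eqP nb]]; have := cp (p1, b).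
  by rewrite /glued vb nb /= -l12 eqxx l1 => /eqP.
have lp' : lab p' = Some v by rewrite -lpp'.
rewrite -(IH p' lp' pth qE); case/orP: st => st; first exact: step.
by rewrite (step p' p) // lpp'.
Qed.

(** Pixels outside all branch sets are summed over freely, each giving a factor n. *)
Definition free_count : C := \prod_p (if lab p == None then n%:R else 1).

Lemma free_count_neq0 : free_count != 0.
Proof.
apply/prodf_neq0 => p _; case: ifP => _; rewrite ?oner_neq0 //.
by case: scheme => n_gt0 _ _ _ _; rewrite pnatr_eq0 -lt0n.
Qed.

(** The identity weights leave only states constant on branch sets; these are states on V together
    with free values at unlabelled pixels. Loops have no link and enter through their diagonal
    coefficient at [ord0]. *)
Lemma scaffold_cylinder :
  cylinder_sum rel (fun p => slot_weight (p, true)) (fun p => slot_weight (p, false)) *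
    \prod_(e | ch e == None) c e ord0 =
  free_count * scaffold0 ends w.
Proof.
have [reps _ _] := lab_minor.
have [rep repP] := fin_all_exists reps.
pose res (psi : {ffun pixel -> 'I_n}) : {ffun V -> 'I_n} := [ffun v => psi (rep v)].
pose term (phi : {ffun V -> 'I_n}) := \prod_e w e (phi (ends e).1) (phi (ends e).2).
have wsym e x y : w e x y = w e y x by rewrite -{1}[w e](bm_sym scheme) mxE.
transitivity (\sum_(psi | compat psi) term (res psi)).
  rewrite mulr_suml [RHS]big_mkcond; apply: eq_bigr => psi _.
  rewrite cylinder_term; case: (boolP (compat psi)) => [cp|_]; last by rewrite !mul0r.
  rewrite mul1r [X in _ * X]big_mkcond -big_split /=; apply: eq_bigr => e _.
  rewrite /edge_factor !ffunE; have := chP e; case: (ch e) => [s /= [vs]|/= ->].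
    rewrite mulr1; case=> -[l1 l2]; last rewrite wsym;
    by rewrite (compat_lab cp l1 (repP _)) (compat_lab cp l2 (repP _)).
  by rewrite mul1r /w bmE rel_diag.
rewrite (partition_big res predT) //= /scaffold0 mulr_sumr; apply: eq_bigr => phi _.
rewrite [LHS](eq_bigr (fun=> term phi)) => [|psi /andP[_ /eqP->] //].
rewrite -[term phi in LHS]mul1r -mulr_suml; congr (_ * _).
(* The compatible states over phi form a product set: one value at labelled pixels, all values
   elsewhere. *)
pose F p : pred 'I_n := fun x => if lab p is Some v then x == phi v else true.
transitivity (\sum_(psi in family F) \prod_(p : pixel) (1 : C)).
  apply: eq_big => [psi|psi _]; last by rewrite big1.
  apply/idP/familyP => [/andP[cp /eqP resE] p|fam].
    rewrite unfold_in /F -resE; case: (lab p) (@compat_lab psi p) => [v|] // clab.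
    by rewrite ffunE (clab (rep v) v).
  have psiE p v : lab p = Some v -> psi p = phi v.
    by move=> lp; have := fam p; rewrite unfold_in /F lp => /eqP.
  apply/andP; split; last by apply/eqP/ffunP=> v; rewrite ffunE (psiE _ v).
  apply/forallP=> s; apply/implyP=> /andP[vs /andP[/eqP gs]].
  case ls: (lab s.1) => [v|] // _; apply/eqP.
  by rewrite (psiE _ v) // (psiE _ v) // -gs.
rewrite -(bigA_distr_big_dep _ (fun _ _ => 1)) /=; apply: eq_bigr => p _; rewrite /F.
case: (lab p) => [v|] /=; first by rewrite big_pred1_eq.
by rewrite sumr_const card_ord.
Qed.

End Weights.
End GridMinor.

(** * Planar graphs as grid minors *)

Section DiscreteDrawing.
Variables (V Ed : finType) (ends : Ed -> V * V).

(** The pairs whose parts of the drawing must be disjoint; a vertex and an incident edge are exempt,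
    since they meet where the edge is cut. *)
Definition apart (o o' : V + Ed) : bool :=
  match o, o' with
  | inl u, inl v => u != v
  | inr e, inr e' => e != e'
  | inl u, inr e | inr e, inl u => (u != (ends e).1) && (u != (ends e).2)
  end.

Variables (a b L : nat) (q : Ed -> nat -> nat * nat) (base : V -> nat * nat).

(* [occ o p]: the pixel p lies on the part of the drawing owned by o, where the first
   a + 1 and last L - b + 1 pixels of an edge path belong to its ends. *)
Definition occ (o : V + Ed) (p : nat * nat) : Prop :=
  match o with
  | inl u => base u = p \/ exists e l, q e l = p /\
      (((l <= a)%N /\ (ends e).1 = u) \/ ((b <= l <= L)%N /\ (ends e).2 = u))
  | inr e => exists l, q e l = p /\ (a <= l <= b)%N
  end.

Definition near (p p' : nat * nat) : Prop :=
  (p.1 = p'.1 /\ (p.2 <= p'.2.+1)%N /\ (p'.2 <= p.2.+1)%N) \/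
  (p.2 = p'.2 /\ (p.1 <= p'.1.+1)%N /\ (p'.1 <= p.1.+1)%N).

Variables (R k : nat).
Hypothesis ab : (a <= b)%N.
Hypothesis bL : (b <= L)%N.
Hypothesis q0 : forall e, q e 0 = base (ends e).1.
Hypothesis qL : forall e, q e L = base (ends e).2.
Hypothesis qstep : forall e l, (l < L)%N -> near (q e l) (q e l.+1).
Hypothesis q_bound : forall e l, (l <= L)%N -> ((q e l).1 <= R)%N /\ ((q e l).2 <= k)%N.
Hypothesis base_bound : forall v, ((base v).1 <= R)%N /\ ((base v).2 <= k)%N.
Hypothesis sep : forall o o' p, occ o p -> occ o' p -> ~~ apart o o'.

Lemma occ_q e l : (l <= L)%N ->
  [\/ occ (inl (ends e).1) (q e l), occ (inl (ends e).2) (q e l) | occ (inr e) (q e l)].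
Proof.
move=> lL; case: (leqP l a) => la.
  by apply: Or31; right; exists e, l; split=> //; left.
case: (leqP b l) => lb; last by apply: Or33; exists l; split=> //; lia.
by apply: Or32; right; exists e, l; split=> //; right; split=> //; lia.
Qed.

(* The stretch i < l < j of the path of e between its last visit to the territory of
   its first end and the next visit to the territory of its second end. *)
Definition bridge e (i j : nat) : Prop :=
  [/\ (i < j <= L)%N, occ (inl (ends e).1) (q e i), occ (inl (ends e).2) (q e j) &
      forall l, (i < l < j)%N ->
        occ (inr e) (q e l) /\ forall u, ~ occ (inl u) (q e l)].

Lemma bridge_exists e : (ends e).1 != (ends e).2 -> exists ij, bridge e ij.1 ij.2.
Proof.
move=> ne.
pose P1 l := (l <= L)%N && boolp.asbool (occ (inl (ends e).1) (q e l)).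
have P10 : exists l, P1 l.
  by exists 0%N; apply/andP; split=> //; apply/boolp.asboolP; left; rewrite q0.
have P1L l : P1 l -> (l <= L)%N by case/andP.
case: (ex_maxnP P10 P1L) => i /andP[iL /boolp.asboolP occi] imax.
have niL : i != L.
  apply/eqP=> iLE; have := sep occi; rewrite iLE qL => /(_ (inl (ends e).2)).
  by rewrite /= ne => /(_ (or_introl erefl)).
pose P2 l := (i < l <= L)%N && boolp.asbool (occ (inl (ends e).2) (q e l)).
have P20 : exists l, P2 l.
  exists L; apply/andP; split; first lia.
  by apply/boolp.asboolP; left; rewrite qL.
case: (ex_minnP P20) => j /andP[ijL /boolp.asboolP occj] jmin.
exists (i, j); split=> //= l ilj.
have lL : (l <= L)%N by lia.
have n1 : ~ occ (inl (ends e).1) (q e l).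
  move=> h; suff : (l <= i)%N by lia.
  by apply: imax; rewrite /P1 lL; apply/boolp.asboolP.
have n2 : ~ occ (inl (ends e).2) (q e l).
  move=> h; suff : (j <= l)%N by lia.
  by apply: jmin; apply/andP; split; [lia | apply/boolp.asboolP].
have [//|//|oe] := occ_q e lL; split=> // u ou.
(* A vertex sharing a pixel with the edge is one of its ends, which the extremal choice of i and j
   excludes. *)
have := @sep (inr e) (inl u) _ oe ou; rewrite /= negb_and !negbK => /orP[/eqP uE|/eqP uE]; rewrite uE in ou;
 by [case: n1|case: n2].
Qed.

Variable br : Ed -> nat * nat.
Hypothesis brP : forall e, (ends e).1 != (ends e).2 -> bridge e (br e).1 (br e).2.

(** Each bridge is annexed by the first end of its edge, so the branch sets of the two ends become
    adjacent at the last step of the bridge. *)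
Definition territory (u : V) (p : nat * nat) : Prop :=
  occ (inl u) p \/ exists e l, [/\ (ends e).1 != (ends e).2, (ends e).1 = u,
    ((br e).1 < l < (br e).2)%N & q e l = p].

Lemma territory_inj u v p : territory u p -> territory v p -> u = v.
Proof.
move=> [ou|[e [l [ne <- ll qp]]]] [ov|[e' [l' [ne' <- ll' qp']]]].
- by have := @sep (inl u) (inl v) _ ou ov; rewrite /= negbK => /eqP.
- have [_ _ _ /(_ l' ll')[_ /(_ u)]] := brP ne'.
  by rewrite qp' => /(_ ou).
- have [_ _ _ /(_ l ll)[_ /(_ v)]] := brP ne.
  by rewrite qp => /(_ ov).
- have [_ _ _ /(_ l ll)[oe _]] := brP ne; have [_ _ _ /(_ l' ll')[oe' _]] := brP ne'.
  rewrite qp' -qp in oe'.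
  by have := @sep (inr e) (inr e') _ oe oe'; rewrite /= negbK => /eqP->.
Qed.

Definition npix (P : 'I_R.+1 * 'I_k.+1) : nat * nat := (P.1 : nat, P.2 : nat).
Definition pix (p : nat * nat) : 'I_R.+1 * 'I_k.+1 := (inord p.1, inord p.2).
Definition terr_lab (P : 'I_R.+1 * 'I_k.+1) : option V :=
  [pick u | boolp.asbool (territory u (npix P))].

Lemma npixK P : pix (npix P) = P.
Proof. by case: P => r i; rewrite /pix /npix /= !inord_val. Qed.

Lemma pixK p : (p.1 <= R)%N -> (p.2 <= k)%N -> npix (pix p) = p.
Proof. by case: p => r i /= rR ik; rewrite /npix /pix /= !inordK. Qed.

Lemma terr_labP P u : terr_lab P = Some u <-> territory u (npix P).
Proof.
rewrite /terr_lab; case: pickP => [v /boolp.asboolP tv|nt].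
  by split=> [[<-]|tu] //; rewrite (territory_inj tv tu).
by split=> // tu; have := nt u; rewrite boolp.asboolT.
Qed.

Lemma territory_bound u p : territory u p -> (p.1 <= R)%N /\ (p.2 <= k)%N.
Proof.
move=> [[<-|[e [l [<- h]]]]|[e [l [ne _ ll <-]]]]; first exact: base_bound.
  by apply: q_bound; case: h => [[la _]|[/andP[_ ?] _]] //; lia.
by apply: q_bound; have [] := brP ne; lia.
Qed.

Lemma near_step p p' : (p.1 <= R)%N -> (p.2 <= k)%N -> (p'.1 <= R)%N -> (p'.2 <= k)%N ->
  near p p' -> p <> p' -> pixel_step (pix p) (pix p') || pixel_step (pix p') (pix p).
Proof.
case: p p' => [r i] [r' i'] /= rR ik r'R i'k.
have stepr x y : (x <= R)%N -> (y < k)%N -> pixel_step (pix (x, y)) (pix (x, y.+1)).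
  move=> xR yk; apply/existsP; exists true; rewrite /valid_slot /next_pixel /= inordK ?yk ?ltnS ?(ltnW yk) //.
  by rewrite /right_px /pix /= inordK ?ltnS ?(ltnW yk).
have stepd x y : (x < R)%N -> (y <= k)%N -> pixel_step (pix (x, y)) (pix (x.+1, y)).
  move=> xR yk; apply/existsP; exists false; rewrite /valid_slot /next_pixel /= inordK ?xR ?ltnS ?(ltnW xR) //.
  by rewrite /down_px /pix /= inordK ?ltnS ?(ltnW xR).
move=> [[/= <- [h1 h2]]|[/= <- [h1 h2]]] ne.
  have [ii'|[ii'|ii']] : i' = i.+1 \/ i = i'.+1 \/ i = i' by lia.
  - by rewrite ii' stepr //; lia.
  - by rewrite ii' stepr ?orbT //; lia.
  - by case: ne; rewrite ii'.
have [rr'|[rr'|rr']] : r' = r.+1 \/ r = r'.+1 \/ r = r' by lia.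
- by rewrite rr' stepd //; lia.
- by rewrite rr' stepd ?orbT //; lia.
- by case: ne; rewrite rr'.
Qed.

Let link := [rel P Q | (terr_lab P == terr_lab Q) && (pixel_step P Q || pixel_step Q P)].

Lemma link_near u p p' : territory u p -> territory u p' -> near p p' ->
  connect link (pix p) (pix p').
Proof.
move=> tp tp' npp'; have [p1 p2] := territory_bound tp; have [p1' p2'] := territory_bound tp'.
have [->|ne] := eqVneq p p'; first exact: connect0.
apply: connect1; rewrite /= near_step //; last exact/eqP.
have -> : terr_lab (pix p) = Some u by apply/terr_labP; rewrite pixK.
have -> : terr_lab (pix p') = Some u by apply/terr_labP; rewrite pixK.
by rewrite eqxx.
Qed.

Lemma link_sym : connect_sym link.
Proof. by apply: sym_connect_sym => P Q /=; rewrite eq_sym orbC. Qed.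

Lemma link_path u e i j : (i <= j <= L)%N ->
  (forall l, (i <= l <= j)%N -> territory u (q e l)) ->
  connect link (pix (q e i)) (pix (q e j)).
Proof.
move=> /andP[]; elim: j => [|j IH] ij jL terr; first by have -> : i = 0%N by lia.
move: ij; rewrite leq_eqVlt => /predU1P[->|ij]; first exact: connect0.
apply: (connect_trans (IH _ _ _)); [lia|lia|by move=> l ?; apply: terr; lia|].
apply: (@link_near u); [apply: terr; lia|apply: terr; lia|exact: qstep].
Qed.

Lemma territory_connected u p : territory u p -> connect link (pix (base u)) (pix p).
Proof.
have conn_occ p' : occ (inl u) p' -> connect link (pix (base u)) (pix p').
  move=> [->|[e [l [<- [[la eu]|[lb eu]]]]]]; first exact: connect0.
    rewrite -eu -q0; apply: (@link_path u); first lia.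
    by move=> l' l'l; left; right; exists e, l'; split=> //; left; split=> //; lia.
  rewrite -eu -qL link_sym; apply: (@link_path u); first lia.
  by move=> l' l'l; left; right; exists e, l'; split=> //; right; split=> //; lia.
move=> [/conn_occ //|[e [l [ne eu ll <-]]]].
have [ij oi oj btw] := brP ne; rewrite eu in oi.
apply: connect_trans (conn_occ _ oi) _; apply: (@link_path u); first lia.
move=> l' /andP[il' l'l]; move: il'; rewrite leq_eqVlt => /predU1P[<-|il']; first by left.
by right; exists e, l'; split=> //; lia.
Qed.

Lemma discrete_grid_minor : grid_minor ends terr_lab.
Proof.
split=> [v|P Q v /terr_labP tP /terr_labP tQ|e ne].
- have [b1 b2] := base_bound v.
  by exists (pix (base v)); apply/terr_labP; rewrite pixK //; left; left.
- rewrite -[P]npixK -[Q]npixK; apply: (@connect_trans _ _ (pix (base v))).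
    by rewrite link_sym; exact: territory_connected.
  exact: territory_connected.
have [ij oi oj btw] := brP ne.
have tj : territory (ends e).2 (q e (br e).2) by left.
have ti : territory (ends e).1 (q e (br e).2.-1).
  have [<-|ilt] : (br e).1 = (br e).2.-1 \/ ((br e).1 < (br e).2.-1)%N by lia.
    by left.
  by right; exists e, (br e).2.-1; split=> //; lia.
have [bi1 bi2] := territory_bound ti; have [bj1 bj2] := territory_bound tj.
exists (pix (q e (br e).2.-1)), (pix (q e (br e).2)); split.
- by apply/terr_labP; rewrite pixK.
- by apply/terr_labP; rewrite pixK.
apply: near_step => //.
  have := @qstep e (br e).2.-1; rewrite prednK; last by lia.
  by apply; lia.
by move=> eqq; rewrite -eqq in tj; move/eqP: ne; apply; exact: territory_inj ti tj.
Qed.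

End DiscreteDrawing.

(** * Compactness for continuous curves, and rounding to pixels *)

Section RealCurves.
Local Open Scope R_scope.

Definition cont01 (f : R -> R) := forall t, unitI t -> continue_in f unitI t.

(** [continue_in] speaks of punctured neighbourhoods; the case x = t is added here. *)
Lemma cont01P f t eps : cont01 f -> unitI t -> 0 < eps ->
  exists alp, 0 < alp /\
    forall x, unitI x -> Rabs (x - t) < alp -> Rabs (f x - f t) < eps.
Proof.
move=> cf ut eps0; have [alp [alp0 h]] := cf t ut eps eps0.
exists alp; split=> // x ux xt.
have [->|ne] := boolp.pselect (x = t).
  by rewrite Rminus_diag Rabs_R0.
apply: h; split=> //; split=> // tx; exact: ne.
Qed.

Lemma unif_cont01 f eps : cont01 f -> 0 < eps ->
  exists d, 0 < d /\ forall x y, unitI x -> unitI y -> Rabs (x - y) < d ->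
    Rabs (f x - f y) < eps.
Proof.
move=> cf eps0.
(* The radius 2 dl leaves room for a second point: x is within dl of u, and y within d <= dl of
   x. *)
have /boolp.choice[delta deltaP] : forall u, exists dl : posreal, unitI u ->
    forall x, unitI x -> Rabs (x - u) < 2 * dl -> Rabs (f x - f u) < eps / 2.
  move=> u; have [uu|nu] := boolp.pselect (unitI u); last by exists (mkposreal 1 Rlt_0_1).
  have [|alp [alp0 h]] := @cont01P f u (eps / 2) cf uu; first lra.
  have alp2 : 0 < alp / 2 by lra.
  by exists (mkposreal _ alp2) => _ x ux /= xu; apply: h => //; lra.
have [d dP] := Compactness.compactness_value_1d 0 1 delta.
exists d; split=> [|x y ux uy xy]; first exact: cond_pos.
apply: boolp.contrapT => nh; apply: (dP x ux) => -[u [uu [xu du]]]; apply: nh.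
have d0 := cond_pos (delta u).
have fx : Rabs (f x - f u) < eps / 2 by apply: deltaP => //; lra.
have fy : Rabs (f y - f u) < eps / 2.
  by apply: deltaP => //; move: xy xu; split_Rabs; lra.
by move: fx fy; split_Rabs; lra.
Qed.

(** At each pair of parameters some coordinate differs, and by continuity keeps a positive gap
    nearby; compactness of the parameter rectangle makes the gap uniform. *)
Lemma curves_apart f1 f2 g1 g2 s0 s1 t0 t1 :
  cont01 f1 -> cont01 f2 -> cont01 g1 -> cont01 g2 ->
  0 <= s0 -> s1 <= 1 -> 0 <= t0 -> t1 <= 1 ->
  (forall s t, s0 <= s <= s1 -> t0 <= t <= t1 -> ~ (f1 s = g1 t /\ f2 s = g2 t)) ->
  exists eps, 0 < eps /\ forall s t, s0 <= s <= s1 -> t0 <= t <= t1 ->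
    eps <= Rabs (f1 s - g1 t) \/ eps <= Rabs (f2 s - g2 t).
Proof.
move=> cf1 cf2 cg1 cg2 hs0 hs1 ht0 ht1 disj.
have nbhd f g u v : cont01 f -> cont01 g -> unitI u -> unitI v -> f u <> g v ->
    exists dl, 0 < dl /\ forall x y, unitI x -> unitI y ->
      Rabs (x - u) < dl -> Rabs (y - v) < dl -> dl <= Rabs (f x - g y).
  move=> cf cg uu uv ne.
  have r0 : 0 < Rabs (f u - g v) by apply: Rabs_pos_lt; lra.
  have r4 : 0 < Rabs (f u - g v) / 4 by lra.
  have [a1 [a10 h1]] := cont01P cf uu r4; have [a2 [a20 h2]] := cont01P cg uv r4.
  exists (Rmin (Rmin a1 a2) (Rabs (f u - g v) / 4)); split.
    by do !apply: Rmin_glb_lt.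
  move=> x y ux uy.
  have := Rmin_l (Rmin a1 a2) (Rabs (f u - g v) / 4).
  have := Rmin_r (Rmin a1 a2) (Rabs (f u - g v) / 4).
  have := Rmin_l a1 a2; have := Rmin_r a1 a2.
  set m' := Rmin a1 a2; set m := Rmin m' _; move: m' m => m' m m1 m2 m3 m4 xu yv.
  have fx := h1 x ux; have fy := h2 y uy.
  have {}fx : Rabs (f x - f u) < Rabs (f u - g v) / 4 by apply: fx; lra.
  have {}fy : Rabs (g y - g v) < Rabs (f u - g v) / 4 by apply: fy; lra.
  apply: Rle_trans m3 _; move: fx fy; clear; split_Rabs; lra.
have /boolp.choice[delta deltaP] : forall uv : R * R, exists dl : posreal,
    s0 <= uv.1 <= s1 -> t0 <= uv.2 <= t1 -> forall x y, unitI x -> unitI y ->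
    Rabs (x - uv.1) < dl -> Rabs (y - uv.2) < dl ->
    dl <= Rabs (f1 x - g1 y) \/ dl <= Rabs (f2 x - g2 y).
  move=> [u v] /=.
  have [[us vt]|nuv] := boolp.pselect (s0 <= u <= s1 /\ t0 <= v <= t1); last first.
    by exists (mkposreal 1 Rlt_0_1) => us vt; case: nuv.
  have uu : unitI u by split; lra.
  have uv : unitI v by split; lra.
  have [ne|eq1] := boolp.pselect (f1 u <> g1 v).
    have [dl [dl0 h]] := nbhd _ _ _ _ cf1 cg1 uu uv ne.
    by exists (mkposreal dl dl0) => _ _ x y ux uy xu yv; left; apply: h.
  have ne : f2 u <> g2 v.
    by move=> eq2; apply: (disj u v us vt); split=> //; apply: boolp.contrapT.
  have [dl [dl0 h]] := nbhd _ _ _ _ cf2 cg2 uu uv ne.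
  by exists (mkposreal dl dl0) => _ _ x y ux uy xu yv; right; apply: h.
have [d dP] := Compactness.compactness_value_2d s0 s1 t0 t1 (fun u v => delta (u, v)).
exists d; split=> [|s t hs ht]; first exact: cond_pos.
apply: boolp.contrapT => nh; apply: (dP s t hs ht) => -[u [v [hu [hv [su [tv dd]]]]]]; apply: nh.
have us : unitI s by split; lra.
have ut : unitI t by split; lra.
have [h|h] := deltaP (u, v) hu hv s t us ut su tv; [left|right]; lra.
Qed.

Lemma fin_common_pos (J : finType) (P : J -> R -> Prop) :
  (forall j e e', P j e -> 0 < e' <= e -> P j e') ->
  (forall j, exists e, 0 < e /\ P j e) -> exists e, 0 < e /\ forall j, P j e.
Proof.
move=> mono ex.
suff [e [e0 eP]] : exists e, 0 < e /\ forall j, j \in enum J -> P j e.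
  by exists e; split=> // j; apply: eP; rewrite mem_enum.
elim: (enum J) => [|j s [e [e0 eP]]]; first by exists 1; split=> //; lra.
have [e1 [e10 Pe1]] := ex j; exists (Rmin e e1); split; first exact: Rmin_glb_lt.
have m0 : 0 < Rmin e e1 by exact: Rmin_glb_lt.
move=> j'; rewrite inE => /predU1P[->|/eP Pj'].
  by apply: mono Pe1 _; split=> //; exact: Rmin_r.
by apply: mono Pj' _; split=> //; exact: Rmin_l.
Qed.

Lemma fin_bounded (J : finType) (f : J -> R) :
  exists B, 0 < B /\ forall j, Rabs (f j) <= B.
Proof.
have [j e e' h [e'0 e'e]|j|e [e0 eP]] := @fin_common_pos J (fun j e => Rabs (f j) <= / e).
- by apply: Rle_trans h _; apply: Rinv_le_contravar.
- have h := Rabs_pos (f j); exists (/ (Rabs (f j) + 1)); split; first by apply: Rinv_0_lt_compat; lra.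
  by rewrite Rinv_inv; lra.
- by exists (/ e); split=> //; exact: Rinv_0_lt_compat.
Qed.

Definition nfl (x : R) : nat :=
  match Rle_dec 0 x with
  | left x0 => sval (Rcomplements.nfloor_ex x x0)
  | right _ => O
  end.

Lemma nflP x : 0 <= x -> INR (nfl x) <= x < INR (nfl x) + 1.
Proof. by rewrite /nfl; case: Rle_dec => [x0 _|//]; case: Rcomplements.nfloor_ex. Qed.

Section Pixel.
Variables (B dl : R).
Hypothesis dl0 : 0 < dl.
Definition pixel_coord (x : R) : nat := nfl ((x + B) / dl).

Lemma pixel_coordP x : Rabs x <= B ->
  INR (pixel_coord x) * dl <= x + B < (INR (pixel_coord x) + 1) * dl.
Proof.
move=> xB; have x0 : 0 <= x + B by move: xB; split_Rabs; lra.
have [h1 h2] := @nflP ((x + B) / dl) (Rle_mult_inv_pos _ _ x0 dl0).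
rewrite -/(pixel_coord x) in h1 h2.
have divK : (x + B) / dl * dl = x + B by rewrite /Rdiv Rmult_assoc Rinv_l ?Rmult_1_r //; lra.
by rewrite -divK; split; [apply: Rmult_le_compat_r; lra | apply: Rmult_lt_compat_r].
Qed.

Lemma pixel_coord_close x y : Rabs x <= B -> Rabs y <= B -> Rabs (x - y) < dl ->
  (pixel_coord x <= (pixel_coord y).+1)%N.
Proof.
move=> xB yB xy; have [h1 _] := pixel_coordP xB; have [_ h2] := pixel_coordP yB.
rewrite -ltnS; apply/ssrnat.ltP/INR_lt; rewrite !S_INR.
apply: (Rmult_lt_reg_r dl) => //; move: xy; split_Rabs; lra.
Qed.

Lemma pixel_coord_eq x y : Rabs x <= B -> Rabs y <= B ->
  pixel_coord x = pixel_coord y -> Rabs (x - y) < dl.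
Proof.
move=> xB yB xy; have h1 := pixel_coordP xB; have h2 := pixel_coordP yB.
by rewrite xy in h1; split_Rabs; lra.
Qed.

End Pixel.
End RealCurves.

(** * Equidistant sampling of the unit interval *)

Section SampleTimes.
Local Open Scope R_scope.
Variable T : nat.
Hypothesis T0 : (0 < T)%N.

(** The number of samples is a multiple of 3, so the cuts at 1/3 and 2/3 are the sample times T and
    2 T. *)
Definition tm (i : nat) : R := INR i / INR (3 * T).

Let N0 : 0 < INR (3 * T).
Proof. by apply: lt_0_INR; lia. Qed.

Lemma tm_le i j : (i <= j)%N -> tm i <= tm j.
Proof.
move=> ij; apply: Rmult_le_compat_r; first exact: Rlt_le (Rinv_0_lt_compat _ N0).
by apply: le_INR; lia.
Qed.

Lemma tmT c : tm (c * T) = INR c / 3.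
Proof.
have T0' : 0 < INR T by apply: lt_0_INR; lia.
rewrite /tm /Rdiv !mult_INR Rinv_mult.
rewrite (_ : INR 3 = 3); last by rewrite /=; lra.
rewrite Rmult_assoc (Rmult_comm (/ 3)) -(Rmult_assoc (INR T)) Rinv_r ?Rmult_1_l //; lra.
Qed.

Lemma tmS i : tm i.+1 = tm i + / INR (3 * T).
Proof. by rewrite /tm S_INR /Rdiv Rmult_plus_distr_r Rmult_1_l. Qed.

Lemma tm0 : tm 0 = 0.
Proof. by have := tmT 0; rewrite mul0n => ->; rewrite /=; lra. Qed.

Lemma tm1 : tm (3 * T) = 1.
Proof. by rewrite tmT /=; lra. Qed.

Lemma tm_unit i : (i <= 3 * T)%N -> unitI (tm i).
Proof. by move=> i3; split; [rewrite -tm0|rewrite -tm1]; apply: tm_le. Qed.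

End SampleTimes.

(** * Pixelation of a planar drawing *)

Section PlanarGrid.
Local Open Scope R_scope.
Variables (V Ed : finType) (ends : Ed -> V * V).
Variables (px py : V -> R) (gx gy : Ed -> R -> R).
Hypothesis pinj : forall u v, px u = px v -> py u = py v -> u = v.
Hypothesis gx_cont : forall e, cont01 (gx e).
Hypothesis gy_cont : forall e, cont01 (gy e).
Hypothesis gends : forall e, gx e 0 = px (ends e).1 /\ gy e 0 = py (ends e).1 /\
  gx e 1 = px (ends e).2 /\ gy e 1 = py (ends e).2.
Hypothesis ginj : forall e s t, unitI s -> unitI t -> s < t ->
  gx e s = gx e t -> gy e s = gy e t -> s = 0 /\ t = 1 /\ (ends e).1 = (ends e).2.
Hypothesis gavoid : forall e t v, openI t -> ~ (gx e t = px v /\ gy e t = py v).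
Hypothesis gdisj : forall e e' s t, e <> e' -> openI s -> openI t ->
  ~ (gx e s = gx e' t /\ gy e s = gy e' t).

(* The drawing is cut at parameters 1/3 and 2/3: the outer thirds of an edge belong
   to its ends, the middle third to the edge. *)
Definition owned (o : V + Ed) (x y : R) : Prop :=
  match o with
  | inl u => (x = px u /\ y = py u) \/ exists e t, [/\ openI t, gx e t = x, gy e t = y &
      (t <= 1 / 3 /\ (ends e).1 = u) \/ (2 / 3 <= t /\ (ends e).2 = u)]
  | inr e => exists t, [/\ 1 / 3 <= t <= 2 / 3, gx e t = x & gy e t = y]
  end.

Lemma inner_eq e e' s t : openI s -> openI t -> gx e s = gx e' t -> gy e s = gy e' t ->
  e = e' /\ s = t.
Proof.
move=> os ot hx hy; have ee' : e = e'.
  by apply: boolp.contrapT => ne; apply: (@gdisj e e' s t ne os ot).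
subst e'; split=> //.
have us : unitI s by move: os; rewrite /openI /unitI; lra.
have ut : unitI t by move: ot; rewrite /openI /unitI; lra.
have [//|ne] := boolp.pselect (s = t).
have [st|st] : s < t \/ t < s by lra.
  by have [s0 _] := ginj us ut st hx hy; move: os; rewrite /openI; lra.
by have [s0 _] := ginj ut us st (esym hx) (esym hy); move: ot; rewrite /openI; lra.
Qed.

Lemma owned_apart o o' x y : owned o x y -> owned o' x y -> ~~ apart ends o o'.
Proof.
have mixed u e : owned (inl u) x y -> owned (inr e) x y ->
    (u == (ends e).1) || (u == (ends e).2).
  move=> hu [t [ht hx hy]]; have ot : openI t by split; lra.
  case: hu => [[hx' hy']|[e' [t' [ot' hx' hy' h]]]].
    by exfalso; apply: (@gavoid e t u ot); rewrite hx hy.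
  have [ee' _] : e' = e /\ t' = t by apply: inner_eq => //; congruence.
  by subst e'; case: h => [[_ ->]|[_ ->]]; rewrite eqxx ?orbT.
case: o o' => [u|e] [v|e'].
- move=> hu hv; rewrite /= negbK; apply/eqP.
  case: hu hv => [[hx hy]|[e [t [ot hx hy h]]]] [[hx' hy']|[e' [t' [ot' hx' hy' h']]]].
  + by apply: pinj; congruence.
  + exfalso; apply: (@gavoid e' t' u ot'); split; congruence.
  + exfalso; apply: (@gavoid e t v ot); split; congruence.
  have [ee' tt'] : e = e' /\ t = t' by apply: inner_eq => //; congruence.
  subst e' t'; case: h h' => [[h1 <-]|[h1 <-]] [[h2 <-]|[h2 <-]] //; exfalso; lra.
- by move=> hu he; rewrite /= negb_and !negbK; apply: mixed.
- by move=> he hu; rewrite /= negb_and !negbK; apply: mixed.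
move=> [t [ht hx hy]] [t' [ht' hx' hy']]; rewrite /= negbK; apply/eqP.
have ot : openI t by split; lra.
have ot' : openI t' by split; lra.
by have [] : e = e' /\ t = t' by apply: inner_eq => //; congruence.
Qed.

(* pieces: a vertex, or the first (Some false), middle (None), last (Some true) third of an edge *)
Local Notation piece := (V + Ed * option bool)%type.
Definition piece_x (j : piece) (t : R) : R :=
  match j with inl v => px v | inr (e, _) => gx e t end.
Definition piece_y (j : piece) (t : R) : R :=
  match j with inl v => py v | inr (e, _) => gy e t end.
Definition piece_lo (j : piece) : R :=
  match j with inr (_, None) => 1 / 3 | inr (_, Some true) => 2 / 3 | _ => 0 end.
Definition piece_hi (j : piece) : R :=
  match j with inr (_, None) => 2 / 3 | inr (_, Some false) => 1 / 3 | _ => 1 end.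
Definition piece_owner (j : piece) : V + Ed :=
  match j with
  | inl v => inl v
  | inr (e, None) => inr e
  | inr (e, Some false) => inl (ends e).1
  | inr (e, Some true) => inl (ends e).2
  end.

Lemma piece_owned j t : piece_lo j <= t <= piece_hi j ->
  owned (piece_owner j) (piece_x j t) (piece_y j t).
Proof.
case: j => [v|[e [[|]|]]] /=; first by left.
- move=> ht; have [g0 [g1 [g2 g3]]] := gends e; have [->|ne] := boolp.pselect (t = 1).
    by left.
  by right; exists e, t; split=> //; [split; lra|right; split=> //; lra].
- move=> ht; have [g0 [g1 [g2 g3]]] := gends e; have [->|ne] := boolp.pselect (t = 0).
    by left.
  by right; exists e, t; split=> //; [split; lra|left; split=> //; lra].
by move=> ht; exists t.
Qed.

Lemma cont01_cst c : cont01 (fun=> c).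
Proof.
move=> t _ eps eps0; exists 1; split; first lra.
by move=> x _; rewrite /dist /= /R_dist Rminus_diag Rabs_R0.
Qed.

Lemma pieces_apart : exists eps, 0 < eps /\ forall j j',
  apart ends (piece_owner j) (piece_owner j') -> forall s t,
  piece_lo j <= s <= piece_hi j -> piece_lo j' <= t <= piece_hi j' ->
  eps <= Rabs (piece_x j s - piece_x j' t) \/ eps <= Rabs (piece_y j s - piece_y j' t).
Proof.
have xcont j : cont01 (piece_x j) by case: j => [v|[e ?]]; [exact: cont01_cst|exact: gx_cont].
have ycont j : cont01 (piece_y j) by case: j => [v|[e ?]]; [exact: cont01_cst|exact: gy_cont].
have lo0 j : 0 <= piece_lo j by case: j => [v|[e [[|]|]]] /=; lra.
have hi1 j : piece_hi j <= 1 by case: j => [v|[e [[|]|]]] /=; lra.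
have [jj e e' h [e'0 e'e] ap s t hs ht|[j j']|eps [eps0 epsP]] :=
  @fin_common_pos (piece * piece)%type (fun jj eps =>
    apart ends (piece_owner jj.1) (piece_owner jj.2) -> forall s t,
    piece_lo jj.1 <= s <= piece_hi jj.1 -> piece_lo jj.2 <= t <= piece_hi jj.2 ->
    eps <= Rabs (piece_x jj.1 s - piece_x jj.2 t) \/
    eps <= Rabs (piece_y jj.1 s - piece_y jj.2 t)).
- by have [h'|h'] := h ap s t hs ht; [left|right]; lra.
- case: (boolP (apart ends (piece_owner j) (piece_owner j'))) => ap; last first.
    by exists 1; split; [lra | move=> ap'; case/negP: ap].
  have [|eps [eps0 h]] := curves_apart (xcont j) (ycont j) (xcont j') (ycont j')
    (lo0 j) (hi1 j) (lo0 j') (hi1 j').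
    move=> s t hs ht [hx hy]; have := piece_owned ht; rewrite -hx -hy => ow.
    by have := owned_apart (piece_owned hs) ow; rewrite ap.
  by exists eps.
- by exists eps; split=> // j j'; exact: (epsP (j, j')).
Qed.

Lemma planar_drawing_grid_minor : exists (R k : nat) lab, @grid_minor V Ed ends R k lab.
Proof.
have [eps [eps0 epsP]] := pieces_apart.
(* Two pieces sharing a pixel have x-coordinates within 3 dl: dl for the pixel and dl for the
   sampling lag of each piece. *)
pose dl := eps / 3; have dl0 : 0 < dl by rewrite /dl; lra.
have [e d d' h [d'0 d'd] x y ux uy xy|e|d [d0 dP]] := @fin_common_pos Ed (fun e d =>
  forall x y, unitI x -> unitI y -> Rabs (x - y) < d ->
  Rabs (gx e x - gx e y) < dl /\ Rabs (gy e x - gy e y) < dl).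
- by apply: h => //; lra.
- have [d1 [d10 h1]] := unif_cont01 (gx_cont e) dl0.
  have [d2 [d20 h2]] := unif_cont01 (gy_cont e) dl0.
  exists (Rmin d1 d2); split; first exact: Rmin_glb_lt.
  move=> x y ux uy xy; have := Rmin_l d1 d2; have := Rmin_r d1 d2.
  by split; [apply: h1|apply: h2] => //; lra.
have [T [Td /ssrnat.ltP T0]] := archimed_cor1 d d0.
have N0 : 0 < INR (3 * T) by apply: lt_0_INR; lia.
have Nd : / INR (3 * T) < d.
  apply: Rle_lt_trans Td; apply: Rinv_le_contravar; first by apply: lt_0_INR; lia.
  by apply: le_INR; lia.
have close e i : (i < 3 * T)%N ->
    Rabs (gx e (tm T i.+1) - gx e (tm T i)) < dl /\ Rabs (gy e (tm T i.+1) - gy e (tm T i)) < dl.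
  move=> iN; apply: dP; [apply: tm_unit => //; lia|apply: tm_unit => //; lia|].
  rewrite tmS (_ : _ - _ = / INR (3 * T)); last lra.
  by have := Rinv_0_lt_compat _ N0; split_Rabs; lra.
have [B [B0 BP]] := @fin_bounded ((V + Ed * 'I_(3 * T).+1) * bool)%type (fun jb =>
  match jb with
  | (inl v, true) => px v | (inl v, false) => py v
  | (inr (e, i), true) => gx e (tm T i) | (inr (e, i), false) => gy e (tm T i)
  end).
have pxB v : Rabs (px v) <= B by exact: (BP (inl v, true)).
have pyB v : Rabs (py v) <= B by exact: (BP (inl v, false)).
have gxB e i : (i <= 3 * T)%N -> Rabs (gx e (tm T i)) <= B.
  by move=> iN; have := BP (inr (e, inord i), true); rewrite inordK.
have gyB e i : (i <= 3 * T)%N -> Rabs (gy e (tm T i)) <= B.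
  by move=> iN; have := BP (inr (e, inord i), false); rewrite inordK.
pose Pc := pixel_coord B dl.
(* A staircase: each sample step is split into an x-move followed by a y-move, so consecutive pixels
   differ in one coordinate only. Hence L = 6 T, with the cuts at 2 T and 4 T. *)
pose q e l := (Pc (gx e (tm T (uphalf l))), Pc (gy e (tm T l./2))).
pose base v := (Pc (px v), Pc (py v)).
pose L := (6 * T)%N.
pose R := (\max_(v : V) (base v).1 + \max_(j : Ed * 'I_L.+1) (q j.1 j.2).1)%N.
pose k := (\max_(v : V) (base v).2 + \max_(j : Ed * 'I_L.+1) (q j.1 j.2).2)%N.
have q0 e : q e 0%N = base (ends e).1.
  by have [g0 [g1 _]] := gends e; rewrite /q /base /= tm0 // g0 g1.
have qL e : q e L = base (ends e).2.
  have [_ [_ [g0 g1]]] := gends e; rewrite /q /base.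
  rewrite (_ : uphalf L = 3 * T)%N; last by rewrite /L; lia.
  by rewrite (_ : L./2 = 3 * T)%N ?tm1 // ?g0 ?g1 // /L; lia.
have qstep e l : (l < L)%N -> near (q e l) (q e l.+1).
  move=> lL; rewrite /near /q /=; case: (boolP (odd l)) => ol; last first.
    right; rewrite (_ : uphalf l = l./2)%N; last by lia.
    have [h _] := close e l./2 ltac:(lia).
    split=> //; split; apply: pixel_coord_close => //; try (apply: gxB; lia).
    by rewrite Rabs_minus_sym.
  left; rewrite (_ : uphalf l = l./2.+1)%N; last by lia.
  have [_ h] := close e l./2 ltac:(lia).
  split=> //; split; apply: pixel_coord_close => //; try (apply: gyB; lia).
  by rewrite Rabs_minus_sym.
have q_bound e l : (l <= L)%N -> ((q e l).1 <= R)%N /\ ((q e l).2 <= k)%N.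
  move=> lL; have <- : (inord l : 'I_L.+1) = l :> nat by rewrite inordK.
  split; apply: leq_trans (leq_addl _ _).
    exact: (leq_bigmax (F := fun j : Ed * 'I_L.+1 => (q j.1 j.2).1) (e, inord l)).
  exact: (leq_bigmax (F := fun j : Ed * 'I_L.+1 => (q j.1 j.2).2) (e, inord l)).
have base_bound v : ((base v).1 <= R)%N /\ ((base v).2 <= k)%N.
  split; apply: leq_trans (leq_addr _ _).
    exact: (leq_bigmax (F := fun v => (base v).1)).
  exact: (leq_bigmax (F := fun v => (base v).2)).
(* The x-coordinate of a pixel may come from one sample later than its y-coordinate; x is that later
   value, within dl of the piece at time t. *)
have occ_piece o p : occ ends (2 * T) (4 * T) L q base o p -> exists j t x,
    [/\ piece_owner j = o, piece_lo j <= t <= piece_hi j,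
        Rabs (piece_x j t - x) < dl /\ Rabs x <= B, Rabs (piece_y j t) <= B &
        Pc x = p.1 /\ Pc (piece_y j t) = p.2].
  have tm13 l : (l./2 <= T)%N -> tm T l./2 <= 1 / 3.
    by move=> h; rewrite -(tmT T0 1) mul1n; apply: tm_le.
  have tm31 l : (T <= l./2)%N -> 1 / 3 <= tm T l./2.
    by move=> h; rewrite -(tmT T0 1) mul1n; apply: tm_le.
  have tm23 l : (l./2 <= 2 * T)%N -> tm T l./2 <= 2 / 3.
    by move=> h; rewrite -(tmT T0 2); apply: tm_le.
  have tm32 l : (2 * T <= l./2)%N -> 2 / 3 <= tm T l./2.
    by move=> h; rewrite -(tmT T0 2); apply: tm_le.
  have sample e l : (l <= L)%N ->
      (Rabs (gx e (tm T l./2) - gx e (tm T (uphalf l))) < dl /\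
      Rabs (gx e (tm T (uphalf l))) <= B) /\ Rabs (gy e (tm T l./2)) <= B.
    move=> lL; split; last by apply: gyB; lia.
    split; last by apply: gxB; lia.
    case: (boolP (odd l)) => ol.
      rewrite (_ : uphalf l = l./2.+1)%N; last by lia.
      by rewrite Rabs_minus_sym; have [] := close e l./2 ltac:(lia).
    by rewrite (_ : uphalf l = l./2)%N ?Rminus_diag ?Rabs_R0 //; lia.
  case: o => [u [<-|[e [l [<- [[la eu]|[lb eu]]]]]]|e [l [<- lab]]].
  - exists (inl u), 0, (px u); split=> //=; first lra.
    by rewrite Rminus_diag Rabs_R0.
  - exists (inr (e, Some false)), (tm T l./2), (gx e (tm T (uphalf l))).
    have [h1 h2] := sample e l ltac:(lia); split=> //=; first by rewrite eu.
    have [h _] := tm_unit T0 (i := l./2) ltac:(lia).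
    by split=> //; apply: tm13; lia.
  - exists (inr (e, Some true)), (tm T l./2), (gx e (tm T (uphalf l))).
    have [h1 h2] := sample e l ltac:(lia); split=> //=; first by rewrite eu.
    have [_ h] := tm_unit T0 (i := l./2) ltac:(lia).
    by split=> //; apply: tm32; lia.
  exists (inr (e, None)), (tm T l./2), (gx e (tm T (uphalf l))).
  have [h1 h2] := sample e l ltac:(lia); split=> //=.
  by split; [apply: tm31|apply: tm23]; lia.
have sep o o' p : occ ends (2 * T) (4 * T) L q base o p ->
    occ ends (2 * T) (4 * T) L q base o' p -> ~~ apart ends o o'.
  move=> /occ_piece[j [t [x [jo jt [jx xB] jyB [xp yp]]]]].
  move=> /occ_piece[j' [t' [x' [jo' jt' [jx' xB'] jyB' [xp' yp']]]]].
  apply/negP; rewrite -jo -jo' => ap.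
  have hx : Rabs (x - x') < dl by apply: (pixel_coord_eq dl0 xB xB'); rewrite -/Pc xp xp'.
  have hy : Rabs (piece_y j t - piece_y j' t') < dl.
    by apply: (pixel_coord_eq dl0 jyB jyB'); rewrite -/Pc yp yp'.
  have [h|h] := epsP j j' ap t t' jt jt'; last by move: h hy; rewrite /dl; lra.
  move: h hx jx jx'; rewrite /dl; clear -eps0; split_Rabs; lra.
have ab : (2 * T <= 4 * T)%N by lia.
have bL : (4 * T <= L)%N by rewrite /L; lia.
have /boolp.choice[br brP] : forall e, exists ij, (ends e).1 != (ends e).2 ->
    bridge ends (2 * T) (4 * T) L q base e ij.1 ij.2.
  move=> e; case: (eqVneq (ends e).1 (ends e).2) => [_|ne]; first by exists (0%N, 0%N).
  by have [ij ijP] := bridge_exists ab bL q0 qL sep ne; exists ij.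
exists R, k, (@terr_lab V Ed ends (2 * T) (4 * T) L q base R k br).
exact (discrete_grid_minor ab bL q0 qL qstep q_bound base_bound sep brP).
Qed.

End PlanarGrid.

Lemma planar_grid_minor (V Ed : finType) (ends : Ed -> V * V) : planar_graph ends ->
  exists (R k : nat) lab, @grid_minor V Ed ends R k lab.
Proof.
move=> [px [py [gx [gy [pinj [cont [gends [ginj [gavoid gdisj]]]]]]]]].
apply: (planar_drawing_grid_minor pinj _ _ gends ginj gavoid gdisj).
  by move=> e t ut; have [] := cont e t ut.
by move=> e t ut; have [] := cont e t ut.
Qed.

Theorem mainTheorem1
  (n m d : nat)
  (rel1 : 'I_n -> 'I_n -> 'I_d.+1) (rel2 : 'I_m -> 'I_m -> 'I_d.+1)
  (E1 : 'I_d.+1 -> 'M[Cplx]_n) (E2 : 'I_d.+1 -> 'M[Cplx]_m) :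
  is_sym_assoc_scheme rel1 -> is_sym_assoc_scheme rel2 ->
  is_prim_idempotents rel1 E1 -> is_prim_idempotents rel2 E2 ->
  exactly_triply_regular Cplx rel1 -> exactly_triply_regular Cplx rel2 ->
  (exists sigma, is_DeltaWye rel1 E1 sigma /\ is_DeltaWye rel2 E2 sigma) ->
  forall kappa : 'M[Cplx]_n -> 'M[Cplx]_m,
  (forall c : 'I_d.+1 -> Cplx,
     kappa (\sum_i c i *: adjmx Cplx rel1 i) = \sum_i c i *: adjmx Cplx rel2 i) ->
  forall (V Ed : finType) (ends : Ed -> V * V),
  connected_graph ends -> planar_graph ends ->
  forall w : Ed -> 'M[Cplx]_n, (forall e, inBM rel1 (w e)) ->
  scaffold0 ends w = scaffold0 ends (fun e => kappa (w e)).
Proof.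
move=> scheme1 scheme2 prim1 prim2 etr1 etr2 [sigma [DW1 DW2]] kappa kappaE V Ed ends _ planar w wBM.
(* From here on the operators of both schemes act on the same state space. *)
have [nm _] := same_trivial_idempotent scheme1 scheme2 prim1 prim2 DW1 DW2; subst m.
have [c wE] := fin_all_exists wBM.
have [R [k [lab lab_minor]]] := planar_grid_minor planar.
have [ch chP] := choose_slots lab_minor.
pose H (p : 'I_R.+1 * 'I_k.+1) := slot_weight lab ch c (p, true).
pose Vw (p : 'I_R.+1 * 'I_k.+1) := slot_weight lab ch c (p, false).
have cyl : cylinder_sum rel1 H Vw = cylinder_sum rel2 H Vw.
  rewrite -!trace_cylinder_word.
  have := @cylinder_word_gen Cplx n d k R rel1 rel2 H Vw.
  move=> /(_ _)/(gen_alg_trace scheme1 scheme2); apply.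
  - exact: (bm_pair_mul scheme1 scheme2 prim1 prim2 DW1 DW2).
  - exact: (bm_pair_rowsum scheme1 scheme2 prim1 prim2 DW1 DW2).
  - exact: (Ups_bm_pair scheme1 scheme2 prim1 prim2 etr1 etr2 DW1 DW2).
  - exact: (Delta_bm_pair scheme1 scheme2 prim1 prim2 DW1 DW2).
  (* Links to the right of the last column are invalid, so they have weight 1. *)
  - by move=> p pk l; rewrite /H /slot_weight /valid_slot /= pk ltnn.
have eq_scaffold (w1 w2 : Ed -> 'M[Cplx]_n) : w1 =1 w2 -> scaffold0 ends w1 = scaffold0 ends w2.
  by move=> ww; apply: eq_bigr => phi _; apply: eq_bigr => e _; rewrite ww.
rewrite (eq_scaffold _ (fun e => bm rel1 (c e)) wE).
rewrite (eq_scaffold (fun e => kappa (w e)) (fun e => bm rel2 (c e))); last first.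
  by move=> e; rewrite wE kappaE.
(* [free_count] and the scalar contributed by the loops are the same for both schemes, so equal
   cylinder sums give equal scaffolds. *)
apply: (mulfI (free_count_neq0 lab Cplx scheme1)).
rewrite -(scaffold_cylinder lab_minor chP c scheme1) cyl.
exact: (scaffold_cylinder lab_minor chP c scheme2).
Qed.
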